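(* Let $n,m\ge 1$ and let $\phi:\mathbb{R}_+^m\to\mathbb{R}_+$ be a symmetric form that is Hölder and concave, extended to $\mathbf{H}_+^m$ by $\phi(X)=\phi(\lambda(X))$. Then for any $s,p,q\in(0,1]$ with $p+q\le 1$, and any $K\in\mathbb{C}^{n\times m}$, the function $$(A,B)\ \longmapsto\ \phi\Big(\big(B^{\frac{qs}{2}}K^*A^{ps}KB^{\frac{qs}{2}}\big)^{\frac1s}\Big)$$ is jointly concave on $\mathbf{H}_+^n\times\mathbf{H}_+^m$.
   Context: $\mathbb{R}_+=[0,\infty)$. $\mathbf{H}_+^d$ is the convex cone of $d\times d$ Hermitian positive semidefinite matrices. For Hermitian $X$ of size $d$, $\lambda(X)=(\lambda_1(X),\dots,\lambda_d(X))$ is the vector of eigenvalues in decreasing order, and scalar functions (in particular powers) are applied to Hermitian matrices by spectral calculus. For vectors, products $xy$, powers $x^p$ and the order relations $x\ge y$, $x>y$ are entrywise. A continuous function $\phi:\mathbb{R}_+^d\to\mathbb{R}_+$ is a symmetric form if: (homogeneity) $\phi(tx)=t\phi(x)$ for all $x\in\mathbb{R}_+^d$, $t\in\mathbb{R}_+$; (monotonicity) for $x,y\in\mathbb{R}_+^d$, $\phi(x)\ge\phi(y)$ if $x\ge y$, and $\phi(x)>\phi(y)$ if $x>y$; (symmetry) $\phi(Px)=\phi(x)$ for every permutation $P$ of the coordinates. A symmetric form $\phi$ is Hölder if $\phi(xy)\le\phi(x^p)^{1/p}\phi(y^q)^{1/q}$ for all $x,y\in\mathbb{R}_+^d$ and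 all $p,q\in[1,+\infty]$ with $\frac1p+\frac1q=1$, where $\phi(x^p)^{1/p}$ for $p=+\infty$ is read as the limit as $p\to+\infty$ (equivalently, the inequality is required for $p,q\in(1,\infty)$). It is concave if $\phi(\tau x+(1-\tau)y)\ge\tau\phi(x)+(1-\tau)\phi(y)$ for all $x,y\in\mathbb{R}_+^d$, $\tau\in[0,1]$. The extension of $\phi$ to $\mathbf{H}_+^d$ is $\phi(X)=\phi(\lambda(X))$. *)

(* Defs.v *)
From HB Require Import structures.
From mathcomp Require Import all_boot all_order all_algebra.
From mathcomp Require Import perm sesquilinear spectral.
From mathcomp Require Import complex.
From mathcomp Require Import boolp classical_sets reals topology normedtype exp.

Set Implicit Arguments.
Unset Strict Implicit.
Unset Printing Implicit Defensive.

Import Order.TTheory GRing.Theory Num.Theory Num.Def.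
Import numFieldNormedType.Exports.

Local Open Scope classical_set_scope.
Local Open Scope ring_scope.
Local Open Scope sesquilinear_scope.
Local Open Scope complex_scope.

Section Forms.
Context {R : realType} {m : nat}.
Implicit Types (x y : 'rV[R]_m) (phi : 'rV[R]_m -> R).

Definition vle x y := forall i, x 0 i <= y 0 i.
Definition vlt x y := forall i, x 0 i < y 0 i.
Definition orthant : set 'rV[R]_m := [set x | vle 0 x].
Definition vmul x y : 'rV[R]_m := map2_mx *%R x y.
Definition vpow x (p : R) : 'rV[R]_m := map_mx (fun a => a `^ p) x.

(* A function on the nonnegative orthant is represented by a function on the
   whole space; every condition below only concerns its values on [orthant]. *)
Record symform phi : Prop := SymForm {
  sform_ge0 : forall x, orthant x -> 0 <= phi x;
  sform_continuous : {within orthant, continuous phi};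
  sform_homogeneous : forall x (t : R), orthant x -> 0 <= t ->
    phi (t *: x) = t * phi x;
  sform_le : forall x y, orthant x -> orthant y -> vle y x -> phi y <= phi x;
  sform_lt : forall x y, orthant x -> orthant y -> vlt y x -> phi y < phi x;
  sform_perm : forall x (g : 'S_m), orthant x -> phi (col_perm g x) = phi x
}.

(* The endpoint cases {p, q} = {1, +oo}, read as limits, follow from these. *)
Definition holder_form phi := forall x y (p q : R),
  orthant x -> orthant y -> 1 < p -> 1 < q -> p^-1 + q^-1 = 1 ->
  phi (vmul x y) <= phi (vpow x p) `^ p^-1 * phi (vpow y q) `^ q^-1.

Definition concave_form phi := forall x y (t : R),
  orthant x -> orthant y -> 0 <= t <= 1 ->
  t * phi x + (1 - t) * phi y <= phi (t *: x + (1 - t) *: y).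

End Forms.

Section Matrices.
Context {R : realType}.

(* In the order of R[i], [0 <= z] means that z is real and nonnegative. *)
Definition psdmx {d : nat} (X : 'M[R[i]]_d) : Prop :=
  X \is hermsymmx /\ forall v : 'cV[R[i]]_d, 0 <= (v^t* *m X *m v) 0 0.

(* [spectral_diag X] lists the eigenvalues of a normal X with multiplicity;
   they are real when X is Hermitian, the only case of interest. *)
Definition eigvals {d : nat} (X : 'M[R[i]]_d) : 'rV[R]_d :=
  \row_(i < d) nth 0 (sort (fun a b => b <= a)
    [seq complex.Re (spectral_diag X 0 j) | j <- enum 'I_d]) i.

Definition spectral_fun (f : R -> R) {d : nat} (X : 'M[R[i]]_d) : 'M[R[i]]_d :=
  invmx (spectralmx X)
  *m diag_mx (map_mx (fun z => (f (complex.Re z))%:C) (spectral_diag X))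
  *m spectralmx X.

Definition mxpow {d : nat} (X : 'M[R[i]]_d) (r : R) : 'M[R[i]]_d :=
  spectral_fun (fun a => a `^ r) X.

Definition form_mx {d : nat} (phi : 'rV[R]_d -> R) (X : 'M[R[i]]_d) : R :=
  phi (eigvals X).

Definition jointly_concave_psd {n m : nat}
    (F : 'M[R[i]]_n -> 'M[R[i]]_m -> R) : Prop :=
  forall (A1 A2 : 'M[R[i]]_n) (B1 B2 : 'M[R[i]]_m) (t : R),
  psdmx A1 -> psdmx A2 -> psdmx B1 -> psdmx B2 -> 0 <= t <= 1 ->
  t * F A1 B1 + (1 - t) * F A2 B2 <=
  F (t%:C *: A1 + (1 - t)%:C *: A2) (t%:C *: B1 + (1 - t)%:C *: B2).

End Matrices.

(* Main.v *)
Require Import Defs.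
From mathcomp Require Import all_boot all_order all_algebra.
From mathcomp Require Import perm sesquilinear spectral complex.
From mathcomp Require Import boolp classical_sets reals topology normedtype.
From mathcomp Require Import interval_inference sequences exp ring lra.

(** For [p + q = 1] the function is an infimum of jointly concave ones.  With
    [N = K* A^(ps) K], Horn's inequality and the Holder property of [phi] give
    [phi ((B^(qs/2) N B^(qs/2))^(1/s)) <= p phi ((adj Z N Z)^(1/(ps)))
       + q phi ((W B^(qs) (adj W))^(1/(qs)))] whenever [W Z = 1], and the two
    sides agree, up to a perturbation, for a suitable [Z].  Both terms on the
    right are instances of [A |-> phi ((L* A^r L)^(1/r))].  Since [phi] is monotone
    under weak majorization, the concavity of this map follows from that of the
    sums of the k smallest eigenvalues, hence, after a compression, from that of
    the trace; the latter is Young's inequality combined with Lieb's theorem on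
    [Tr K* A^r K B^(1-r)].  Lieb's theorem holds because the functions [g(x, y)]
    for which [g (left multiplication by A, right multiplication by B)] is jointly
    concave are stable under parallel sums, hence under geometric means and limits.
    For [p + q = r < 1] the first case applies to the form [phi (x^r)^(1/r)]. *)

Set Implicit Arguments.
Unset Strict Implicit.
Unset Printing Implicit Defensive.

Import Order.TTheory GRing.Theory Num.Theory Num.Def.
Import numFieldNormedType.Exports.

Local Open Scope classical_set_scope.
Local Open Scope sesquilinear_scope.
Local Open Scope complex_scope.
Local Open Scope ring_scope.

(** * Adjoints, unitary matrices and diagonalized Hermitian matrices *)

Section Basics.
Context {R : realType}.
Local Notation C := R[i].

(** Fixing [Z] is what decouples the two variables: each Young term then depends on [A] alone or on
    [B] alone. For singular matrices an optimal [Z] need not exist, which is why the variational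
    formula is proved only up to an arbitrary [eta] and why a one-sided continuity of [phi] is
    carried along. The condition [s <= 1] brings the exponents [p * s] and [q * s] into the open
    interval where Lieb's theorem applies. Majorization is stated for a set of vectors, not for a
    function, because it serves in two opposite settings. For the Holder bound the set is a sublevel
    set of [phi] in logarithmic coordinates, and products of the largest eigenvalues are bounded
    from above. For concavity it is a superlevel set in negated coordinates, and sums of the
    smallest eigenvalues are bounded from below. Both bounds come from one test-vector argument, the
    intersection of two coordinate subspaces. *)

Definition nsq (z : C) : R := complex.Re z ^+ 2 + complex.Im z ^+ 2.

Lemma nsqE (z : C) : (nsq z)%:C = z^* * z.
Proof.
case: z => x y; apply/eqP; rewrite eq_complex /nsq /=; apply/andP; split; apply/eqP.
  by rewrite !expr2 mulNr opprK.
by rewrite mulNr mulrC addrN.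
Qed.

Lemma conjC_real (x : R) : (x%:C)^* = x%:C :> C.
Proof. exact: conjc_real. Qed.

Lemma nsq_ge0 z : 0 <= nsq z.
Proof. by rewrite addr_ge0 ?sqr_ge0. Qed.

Lemma nsq_eq0 z : (nsq z == 0) = (z == 0).
Proof. by rewrite /nsq paddr_eq0 ?sqr_ge0 // !sqrf_eq0 eq_complex. Qed.

Lemma nsq0 : nsq 0 = 0.
Proof. by apply/eqP; rewrite nsq_eq0. Qed.

Lemma nsqM z w : nsq (z * w) = nsq z * nsq w.
Proof. by case: z => x y; case: w => u v; rewrite /nsq /=; ring. Qed.

Lemma nsq_real (x : R) : nsq x%:C = x ^+ 2.
Proof. by rewrite /nsq /= expr0n addr0. Qed.

Lemma nsq_conj z : nsq z^* = nsq z.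
Proof. by case: z => x y; rewrite /nsq /= sqrrN. Qed.

Definition adj m n (A : 'M[C]_(m, n)) : 'M[C]_(n, m) := A^t*.

Lemma adjM m n k (A : 'M[C]_(m, n)) (B : 'M[C]_(n, k)) :
  adj (A *m B) = adj B *m adj A.
Proof. by rewrite /adj trmx_mul map_mxM. Qed.

Lemma adjD m n (A B : 'M[C]_(m, n)) : adj (A + B) = adj A + adj B.
Proof. by rewrite /adj linearD map_mxD. Qed.

Lemma adjZ m n (c : C) (A : 'M[C]_(m, n)) : adj (c *: A) = c^* *: adj A.
Proof. by rewrite /adj linearZ map_mxZ. Qed.

Lemma adjK m n (A : 'M[C]_(m, n)) : adj (adj A) = A.
Proof. exact: trmxCK. Qed.

Lemma adjE m n (A : 'M[C]_(m, n)) i j : (adj A) i j = (A j i)^*.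
Proof. by rewrite !mxE. Qed.

Lemma adj1 n : adj (1%:M : 'M[C]_n) = 1%:M.
Proof. by rewrite /adj trmx1 map_mx1. Qed.

Definition dm n (a : 'rV[R]_n) : 'M[C]_n := diag_mx (map_mx (fun x => x%:C) a).
(** Positive matrices are handled through pairs [(U, a)] instead of the chosen [spectralmx], so that
    the order of the eigenvalues can be adapted to each argument. *)
Definition smx n (U : 'M[C]_n) (a : 'rV[R]_n) : 'M[C]_n := adj U *m dm a *m U.

Lemma dmE n (a : 'rV[R]_n) i j : dm a i j = (a 0 i)%:C *+ (i == j).
Proof. by rewrite !mxE; case: eqP => [->|]. Qed.

Lemma adj_dm n (a : 'rV[R]_n) : adj (dm a) = dm a.
Proof.
apply/matrixP => i j; rewrite adjE !dmE eq_sym.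
by case: eqP => [->|_] /=; rewrite ?mulr1n ?mulr0n ?conjC_real ?conjC0.
Qed.

Lemma dmM n (a b : 'rV[R]_n) : dm a *m dm b = dm (vmul a b).
Proof.
rewrite /dm mulmx_diag; congr diag_mx; apply/rowP => i.
by rewrite !mxE rmorphM.
Qed.

Lemma dm_const n (c : R) : dm (const_mx c : 'rV_n) = (c%:C)%:M.
Proof. by rewrite /dm map_const_mx diag_const_mx. Qed.

Lemma dm_col n k (a : 'rV[R]_n) (B : 'M[C]_(n, k)) i j :
  (dm a *m B) i j = (a 0 i)%:C * B i j.
Proof. by rewrite mul_diag_mx !mxE. Qed.

Lemma dm_row n k (a : 'rV[R]_n) (B : 'M[C]_(k, n)) i j :
  (B *m dm a) i j = B i j * (a 0 j)%:C.
Proof. by rewrite mul_mx_diag !mxE. Qed.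

Definition unitary n (U : 'M[C]_n) : Prop := U *m adj U = 1%:M.

Lemma unitaryP n (U : 'M[C]_n) : U \is unitarymx <-> unitary U.
Proof. by split=> /unitarymxP. Qed.

Section Unitary.
Variables (n : nat) (U : 'M[C]_n).
Hypothesis hU : unitary U.

Lemma unitaryKV : adj U *m U = 1%:M.
Proof. exact: mulmx1C. Qed.

Lemma smxM a b : smx U a *m smx U b = smx U (vmul a b).
Proof.
rewrite /smx -(mulmxA (adj U *m dm a) U) -(mulmxA (adj U) (dm b)) (mulmxA U).
by rewrite hU mul1mx -(mulmxA _ (dm a)) (mulmxA (dm a)) dmM mulmxA.
Qed.

Lemma smx_const c : smx U (const_mx c) = (c%:C)%:M.
Proof. by rewrite /smx dm_const mul_mx_scalar -scalemxAl unitaryKV scalemx1. Qed.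

Lemma conj_smx a : U *m smx U a *m adj U = dm a.
Proof.
by rewrite /smx !mulmxA hU mul1mx -mulmxA hU mulmx1.
Qed.
End Unitary.

Lemma adj_smx n (U : 'M[C]_n) a : adj (smx U a) = smx U a.
Proof. by rewrite /smx !adjM adjK adj_dm mulmxA. Qed.

Definition nv n (v : 'cV[C]_n) : R := \sum_i nsq (v i 0).

Lemma nvE n (v : 'cV[C]_n) : (adj v *m v) 0 0 = (nv v)%:C.
Proof.
rewrite mxE /nv rmorph_sum; apply: eq_bigr => i _.
by rewrite adjE /= nsqE.
Qed.

Lemma nv_ge0 n (v : 'cV[C]_n) : 0 <= nv v.
Proof. by apply: sumr_ge0 => i _; apply: nsq_ge0. Qed.

Lemma nv_gt0 n (v : 'cV[C]_n) : v != 0 -> 0 < nv v.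
Proof.
move=> v0; rewrite lt_neqAle nv_ge0 andbT eq_sym; apply: contraNneq v0 => h.
apply/eqP/colP => i; rewrite mxE.
have /(_ i isT) := psumr_eq0P (fun j _ => nsq_ge0 (v j 0)) h.
by move/eqP; rewrite nsq_eq0 => /eqP.
Qed.

Lemma real_inj (x y : R) : x%:C = y%:C :> C -> x = y.
Proof. by move=> /(congr1 (@complex.Re R)). Qed.

Lemma nv_unitary n (U : 'M[C]_n) (v : 'cV[C]_n) :
  unitary U -> nv (U *m v) = nv v.
Proof.
move=> hU; apply: real_inj; rewrite -!nvE adjM mulmxA -(mulmxA _ _ U).
by rewrite (unitaryKV hU) mulmx1.
Qed.

Lemma qf_smx n (U : 'M[C]_n) a (v : 'cV[C]_n) :
  (adj v *m smx U a *m v) 0 0 = (\sum_i a 0 i * nsq ((U *m v) i 0))%:C.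
Proof.
rewrite /smx !mulmxA -adjM -(mulmxA _ U v) -mulmxA mxE rmorph_sum.
apply: eq_bigr => i _; rewrite adjE dm_col rmorphM /= nsqE mulrCA.
by congr (_ * _).
Qed.

Lemma herm_adj n (X : 'M[C]_n) : X \is hermsymmx <-> adj X = X.
Proof.
split; first by move/is_hermitianmxP; rewrite expr0 scale1r /adj => <-.
by move=> h; apply/is_hermitianmxP; rewrite expr0 scale1r -/(adj X) h.
Qed.

Lemma psdmx_smx n (U : 'M[C]_n) a : orthant a -> psdmx (smx U a).
Proof.
move=> ha; split.
  exact/herm_adj/adj_smx.
move=> v; rewrite -/(adj v) qf_smx ler0c sumr_ge0 // => i _.
by rewrite mulr_ge0 ?nsq_ge0 //; have := ha i; rewrite mxE.
Qed.

Lemma herm_spectral n (X : 'M[C]_n) : X \is hermsymmx ->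
  X = smx (spectralmx X) (map_mx (@complex.Re R) (spectral_diag X)).
Proof.
move=> hX; have hr := hermitian_spectral_diag_real hX.
have := orthomx_spectralP (hermitian_normalmx hX).
rewrite (invmx_unitary (spectral_unitarymx X)) /smx /dm /adj.
have : map_mx (fun x => x%:C) (map_mx (@complex.Re R) (spectral_diag X)) =
    spectral_diag X.
  apply/rowP => i; rewrite !mxE.
  have /mxOverP /(_ 0 i) := hr.
  by move: (spectral_diag X 0 i) => z /complex_realP [x ->].
move: (spectralmx X) (spectral_diag X) => P d -> e; exact: e.
Qed.

End Basics.

(** * Independence of the functional calculus from the diagonalization; ordered spectra *)

Section Calculus.
Context {R : realType}.
Local Notation C := R[i].

(** The matrix [V = W *m adj U] intertwines the two diagonals, so [V i j] vanishes unless
    [b 0 i = a 0 j]. It therefore intertwines their images under an arbitrary [f], without any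
    approximation by polynomials. *)
Lemma smx_fun n (U W : 'M[C]_n) (a b : 'rV[R]_n) (f : R -> R) :
  unitary U -> unitary W -> smx U a = smx W b ->
  smx U (map_mx f a) = smx W (map_mx f b).
Proof.
move=> hU hW e; pose V := W *m adj U.
have hV : V *m dm a = dm b *m V.
  have := congr1 (fun X => W *m X *m adj U) e.
  rewrite /smx !mulmxA hW mul1mx -!mulmxA hU mulmx1 !mulmxA.
  by rewrite /V => ->.
have hf : V *m dm (map_mx f a) = dm (map_mx f b) *m V.
  apply/matrixP => i j; have /matrixP /(_ i j) := hV.
  rewrite !dm_row !dm_col !(mxE _ _ 0) mulrC => /eqP.
  rewrite -subr_eq0 -mulrBl mulf_eq0 => /orP[/eqP /subr0_eq /real_inj ->|/eqP ->].
    by rewrite mulrC.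
  by rewrite mulr0 mul0r.
rewrite /smx.
have -> : adj W *m dm (map_mx f b) *m W = adj W *m (dm (map_mx f b) *m V) *m U.
  by rewrite /V !mulmxA -(mulmxA _ (adj U) U) (unitaryKV hU) mulmx1.
by rewrite -hf /V !mulmxA (unitaryKV hW) mul1mx.
Qed.

Lemma spectral_fun_smx n (U : 'M[C]_n) (a : 'rV[R]_n) (f : R -> R) :
  unitary U -> spectral_fun f (smx U a) = smx U (map_mx f a).
Proof.
move=> hU; have hX : smx U a \is hermsymmx by apply/herm_adj/adj_smx.
have hW := spectral_unitarymx (smx U a).
have := herm_spectral hX.
rewrite /spectral_fun (invmx_unitary hW).
move: (spectralmx (smx U a)) (spectral_diag (smx U a)) hW => W d /unitaryP hW e.
rewrite (smx_fun f hU hW e) /smx /adj /dm.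
suff -> : map_mx (fun z => (f (complex.Re z))%:C) d =
  map_mx (fun x => x%:C) (map_mx f (map_mx (@complex.Re R) d)) by [].
by apply/rowP => i; rewrite !mxE.
Qed.

Lemma mxpow_smx n (U : 'M[C]_n) (a : 'rV[R]_n) r :
  unitary U -> mxpow (smx U a) r = smx U (vpow a r).
Proof. exact: spectral_fun_smx. Qed.

Lemma psd_dec n (X : 'M[C]_n) : psdmx X ->
  exists U a, [/\ unitary U, orthant a & X = smx U a].
Proof.
case=> hX pX; have hW := spectral_unitarymx X; have e := herm_spectral hX.
move: (spectralmx X) (map_mx _ _) hW e => W a /unitaryP hW e.
exists W, a; split => //; move=> i; rewrite mxE.
have := pX (adj W *m delta_mx i 0); rewrite e -/(adj _) qf_smx.
rewrite (mulmxA W) hW mul1mx ler0c (bigD1 i) //= big1 => [|k ki].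
  rewrite mxE !eqxx /= addr0 (_ : 1%:R = (1%:C : C)) ?nsq_real ?expr1n ?mulr1 //.
by rewrite mxE (negPf ki) /= nsq0 mulr0.
Qed.

Definition desc n (a : 'rV[R]_n) := forall i j : 'I_n, (i <= j)%N -> a 0 j <= a 0 i.
Definition asc n (a : 'rV[R]_n) := forall i j : 'I_n, (i <= j)%N -> a 0 i <= a 0 j.

Lemma sort_desc n (a : 'rV[R]_n) :
  let b := \row_(i < n) nth 0 (sort (fun x y : R => y <= x)
    [seq a 0 j | j <- enum 'I_n]) i in
  desc b /\ exists s : 'S_n, b = col_perm s a.
Proof.
pose t := [tuple a 0 i | i < n].
have -> : [seq a 0 j | j <- enum 'I_n] = t by [].
set r := sort _ _ => /=.
have sz : size r = n by rewrite size_sort size_tuple.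
split.
  move=> i j ij; rewrite !mxE.
  have tr : transitive (fun x y : R => y <= x).
    by move=> x y z h1 h2; apply: le_trans h2 h1.
  have sr : sorted (fun x y : R => y <= x) r.
    by apply: sort_sorted => x y; apply: le_total.
  by apply: (sorted_leq_nth tr (@lexx _ R) 0 sr) => //; rewrite inE sz.
have pr : perm_eq r t by rewrite perm_sort.
move/tuple_permP: pr => [s hs]; exists s; apply/rowP => k; rewrite !mxE.
by rewrite hs (nth_map k) ?size_enum_ord // ?nth_ord_enum ?tnth_mktuple.
Qed.

Lemma exists_desc n (a : 'rV[R]_n) : exists s : 'S_n, desc (col_perm s a).
Proof. by have [hd [s hs]] := sort_desc a; exists s; rewrite -hs. Qed.

Lemma row_perm_unitary n (U : 'M[C]_n) (s : 'S_n) : unitary U -> unitary (row_perm s U).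
Proof.
move=> hU; rewrite /unitary; apply/matrixP => i j.
have /matrixP /(_ (s i) (s j)) := hU; rewrite !mxE (inj_eq perm_inj) => <-.
by apply: eq_bigr => k _; rewrite !adjE !mxE.
Qed.

Lemma smx_perm n (U : 'M[C]_n) (a : 'rV[R]_n) (s : 'S_n) :
  smx (row_perm s U) (col_perm s a) = smx U a.
Proof.
apply/matrixP => i j; rewrite !mxE [RHS](reindex_inj (@perm_inj _ s)) /=.
by apply: eq_bigr => k _; rewrite !dm_row !adjE !mxE.
Qed.

Lemma psd_dec_desc n (X : 'M[C]_n) : psdmx X ->
  exists U a, [/\ unitary U, orthant a, desc a & X = smx U a].
Proof.
move=> /psd_dec [U [a [hU ha ->]]]; have [s hs] := exists_desc a.
exists (row_perm s U), (col_perm s a); split => //.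
- exact: row_perm_unitary.
- by move=> i; have := ha (s i); rewrite !mxE.
- by rewrite smx_perm.
Qed.

Lemma psd_dec_asc n (X : 'M[C]_n) : psdmx X ->
  exists U a, [/\ unitary U, orthant a, asc a & X = smx U a].
Proof.
move=> /psd_dec [U [a [hU ha ->]]]; have [s hs] := exists_desc (- a).
exists (row_perm s U), (col_perm s a); split => //.
- exact: row_perm_unitary.
- by move=> i; have := ha (s i); rewrite !mxE.
- by move=> i j ij; have := hs i j ij; rewrite !mxE lerN2.
- by rewrite smx_perm.
Qed.

(** A dimension count: a vector supported on [Q] has to satisfy one linear equation for each row
    outside [P], and there are fewer equations than unknowns. *)
Lemma cross_kernel m k (M : 'M[C]_(m, k)) (P : pred 'I_m) (Q : pred 'I_k) :
  (#|predC P| < #|Q|)%N ->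
  exists z : 'cV[C]_k, [/\ z != 0, (forall j, ~~ Q j -> z j 0 = 0) &
    (forall i, ~~ P i -> (M *m z) i 0 = 0)].
Proof.
move=> card.
(* [kermx] is a left kernel, hence the transposed submatrix and the row vector of unknowns. *)
pose A : 'M[C]_(#|Q|, #|predC P|) := \matrix_(j, i) M (enum_val i) (enum_val j).
have : kermx A != 0.
  rewrite -mxrank_eq0 mxrank_ker -lt0n subn_gt0.
  exact: leq_ltn_trans (rank_leq_col A) card.
case/rowV0Pn => u /sub_kermxP uA u0.
have [j0 Qj0] : exists j, Q j.
  have /card_gt0P [j Qj] := leq_ltn_trans (leq0n _) card; by exists j.
pose z : 'cV[C]_k := \col_j (if Q j then u 0 (enum_rank_in Qj0 j) else 0).
have zE (l : 'I_#|Q|) : z (enum_val l) 0 = u 0 l.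
  by have ql : Q (enum_val l) := enum_valP l; rewrite mxE ql enum_valK_in.
exists z; split.
- apply: contraNneq u0 => z0; apply/eqP/rowP => l.
  by rewrite -zE z0 !mxE.
- by move=> j /negPf Qj; rewrite mxE Qj.
- move=> i Pi; have Pi' : i \in predC P by rewrite inE.
  have := congr1 (fun B : 'rV_ _ => B 0 (enum_rank_in Pi' i)) uA.
  rewrite !mxE => e; rewrite (bigID Q) /= [X in _ + X]big1 ?addr0; last first.
    by move=> j /negPf Qj; rewrite mxE Qj mulr0.
  rewrite -[RHS]e (big_enum_val (fun j => M i j * z j 0)) /=.
  apply: eq_bigr => l _; rewrite zE mxE enum_rankK_in //.
  by rewrite mulrC.
Qed.

End Calculus.

(** * Min-max comparison of eigenvalues *)

Section MinMax.
Context {R : realType}.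
Local Notation C := R[i].

(** The quadratic form of [smx U a] with real values: inequalities between Hermitian matrices are
    then stated in [R] and not in the partial order of [C]. *)
Definition qv n (U : 'M[C]_n) (a : 'rV[R]_n) (y : 'cV[C]_n) : R :=
  \sum_i a 0 i * nsq ((U *m y) i 0).

Lemma qvE n (U : 'M[C]_n) (a : 'rV[R]_n) (y : 'cV[C]_n) :
  (adj y *m smx U a *m y) 0 0 = (qv U a y)%:C.
Proof. exact: qf_smx. Qed.

Lemma qv_congr m k (U : 'M[C]_m) (a : 'rV[R]_m) (W : 'M[C]_k) (b : 'rV[R]_k)
    (T : 'M[C]_(m, k)) y :
  smx W b = adj T *m smx U a *m T -> qv W b y = qv U a (T *m y).
Proof.
by move=> e; apply: real_inj; rewrite -!qvE e adjM !mulmxA.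
Qed.

Lemma nv_isometry m k (T : 'M[C]_(m, k)) y :
  adj T *m T = 1%:M -> nv (T *m y) = nv y.
Proof.
by move=> e; apply: real_inj; rewrite -!nvE adjM mulmxA -(mulmxA _ _ T) e mulmx1.
Qed.

Lemma supp_ge n (b : 'rV[R]_n) (z : 'cV[C]_n) (Q : pred 'I_n) beta :
  (forall j, ~~ Q j -> z j 0 = 0) -> (forall j, Q j -> beta <= b 0 j) ->
  beta * nv z <= \sum_j b 0 j * nsq (z j 0).
Proof.
move=> hz hb; rewrite mulr_sumr; apply: ler_sum => j _.
by have [/hb|/hz ->] := boolP (Q j); [exact/ler_wpM2r/nsq_ge0 | rewrite nsq0 !mulr0].
Qed.

Lemma supp_le n (b : 'rV[R]_n) (z : 'cV[C]_n) (Q : pred 'I_n) beta :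
  (forall j, ~~ Q j -> z j 0 = 0) -> (forall j, Q j -> b 0 j <= beta) ->
  \sum_j b 0 j * nsq (z j 0) <= beta * nv z.
Proof.
move=> hz hb; rewrite mulr_sumr; apply: ler_sum => j _.
by have [/hb|/hz ->] := boolP (Q j); [exact/ler_wpM2r/nsq_ge0 | rewrite nsq0 !mulr0].
Qed.

Lemma adj_unitary n (U : 'M[C]_n) : unitary U -> unitary (adj U).
Proof. by move=> hU; rewrite /unitary adjK unitaryKV. Qed.

Lemma card_lt_ord n i (P : pred 'I_n) : (i <= n)%N ->
  (forall l, P l = (l < i)%N) -> #|P| = i.
Proof.
move=> hi hP; rewrite -sum1_card (eq_bigl (fun l : 'I_n => (l < i)%N)); last exact: hP.
by rewrite (big_ord_narrow hi) sum_nat_const card_ord muln1.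
Qed.

(* The two subspaces meet because (j + 1) + (m - i) > m. *)
Lemma minmax_vector m k (U : 'M[C]_m) (W : 'M[C]_k) (T : 'M[C]_(m, k))
    (i : 'I_m) (j : 'I_k) : unitary W -> i = j :> nat ->
  exists y : 'cV[C]_k, [/\ 0 < nv (W *m y),
    (forall l : 'I_k, ~~ (l <= j)%N -> (W *m y) l 0 = 0) &
    (forall l : 'I_m, ~~ (i <= l)%N -> (U *m (T *m y)) l 0 = 0)].
Proof.
move=> hW ij.
have [|z [z0 z1 z2]] := @cross_kernel R m k (U *m T *m adj W)
    (fun l : 'I_m => (i <= l)%N) (fun l : 'I_k => (l <= j)%N).
  rewrite [X in (X < _)%N](_ : _ = i :> nat); last first.
    by apply: card_lt_ord => [|l]; [exact: ltnW | rewrite inE -ltnNge].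
  rewrite [X in (_ < X)%N](_ : _ = j.+1 :> nat); last exact: card_lt_ord.
  by rewrite ij.
have Wy : W *m (adj W *m z) = z by rewrite mulmxA hW mul1mx.
exists (adj W *m z); rewrite Wy; split=> //; first exact: nv_gt0.
by move=> l hl; rewrite !mulmxA; apply: z2.
Qed.

(** Courant-Fischer and Cauchy interlacing in one statement: [T = 1] gives monotonicity of
    eigenvalues, an isometry [T] gives interlacing for a compression. On the test vector one form is
    at least [b 0 j] times the squared norm, the other at most [a 0 i] times it. *)
Lemma eig_le m k (U : 'M[C]_m) (a : 'rV[R]_m) (W : 'M[C]_k) (b : 'rV[R]_k)
    (T : 'M[C]_(m, k)) :
  unitary U -> unitary W -> desc a -> desc b ->
  (forall y, qv W b y <= qv U a (T *m y)) -> (forall y, nv (T *m y) = nv y) ->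
  forall (i : 'I_m) (j : 'I_k), i = j :> nat -> b 0 j <= a 0 i.
Proof.
move=> hU hW da db hq hn i j ij.
have [y [y0 y1 y2]] := minmax_vector U T hW ij.
rewrite -(ler_pM2r y0).
apply: le_trans (supp_ge (beta := b 0 j) y1 _) _; first by move=> l; apply: db.
apply: le_trans (hq y) _.
apply: le_trans (supp_le (beta := a 0 i) y2 _) _; first by move=> l; apply: da.
by rewrite nv_unitary // hn nv_unitary.
Qed.

Lemma eig_ge m k (U : 'M[C]_m) (a : 'rV[R]_m) (W : 'M[C]_k) (b : 'rV[R]_k)
    (T : 'M[C]_(m, k)) :
  unitary U -> unitary W -> asc a -> asc b ->
  (forall y, qv U a (T *m y) <= qv W b y) -> (forall y, nv (T *m y) = nv y) ->
  forall (i : 'I_m) (j : 'I_k), i = j :> nat -> a 0 i <= b 0 j.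
Proof.
have qvN n (V : 'M[C]_n) c y : qv V (- c) y = - qv V c y.
  by rewrite /qv -sumrN; apply: eq_bigr => l _; rewrite mxE mulNr.
move=> hU hW da db hq hn i j ij; rewrite -lerN2.
have := @eig_le m k U (- a) W (- b) T hU hW _ _ _ hn i j ij.
rewrite !mxE; apply.
- by move=> l l' ll; rewrite !mxE lerN2 da.
- by move=> l l' ll; rewrite !mxE lerN2 db.
- by move=> y; rewrite !qvN lerN2.
Qed.

Lemma eig_mono n (U W : 'M[C]_n) (a b : 'rV[R]_n) :
  unitary U -> unitary W -> desc a -> desc b ->
  (forall y, qv W b y <= qv U a y) -> vle b a.
Proof.
move=> hU hW da db h i.
by apply: (@eig_le _ _ U a W b 1%:M) => // y; rewrite mul1mx.
Qed.

Lemma eig_uniq n (U W : 'M[C]_n) (a b : 'rV[R]_n) :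
  unitary U -> unitary W -> desc a -> desc b -> smx U a = smx W b -> a = b.
Proof.
move=> hU hW da db e.
have q y : qv U a y = qv W b y by apply: real_inj; rewrite -!qvE e.
apply/rowP => i; apply/eqP; rewrite eq_le.
by apply/andP; split; [apply: (eig_mono hW hU) | apply: (eig_mono hU hW)] => // y;
  rewrite q.
Qed.

Lemma eigvals_smx n (U : 'M[C]_n) (a : 'rV[R]_n) : unitary U ->
  exists s : 'S_n, eigvals (smx U a) = col_perm s a.
Proof.
move=> hU; have hX : smx U a \is hermsymmx by apply/herm_adj/adj_smx.
have hW := spectral_unitarymx (smx U a).
have := herm_spectral hX; rewrite /eigvals.
move: (spectralmx (smx U a)) (spectral_diag (smx U a)) hW => W d /unitaryP hW.
set b := map_mx _ d => e.
have -> : [seq complex.Re (d 0 j) | j <- enum 'I_n] = [seq b 0 j | j <- enum 'I_n].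
  by apply: eq_map => j; rewrite mxE.
have [dc [s hs]] := sort_desc b; move: hs dc; set c := \row_i _ => hs dc.
have [s' hs'] := exists_desc a.
exists s'; symmetry.
apply: (@eig_uniq _ (row_perm s' U) (row_perm s W)) => //; try exact: row_perm_unitary.
by rewrite hs !smx_perm.
Qed.

Lemma form_mx_smx n (phi : 'rV[R]_n -> R) (U : 'M[C]_n) (a : 'rV[R]_n) :
  (forall x (g : 'S_n), orthant x -> phi (col_perm g x) = phi x) ->
  unitary U -> orthant a -> form_mx phi (smx U a) = phi a.
Proof.
by move=> hp hU ha; rewrite /form_mx; have [s ->] := eigvals_smx a hU; apply: hp.
Qed.

(** Half of the fact that [X *m adj X] and [adj X *m X] have the same spectrum. With [T = X], which
    is no isometry, the test vector satisfies [b i |X y|^2 <= |adj X X y|^2 <= a i |X y|^2], and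
    [|X y| > 0] as soon as [b i > 0]. *)
Lemma eig_swap_le n (X U W : 'M[C]_n) (a b : 'rV[R]_n) :
  unitary U -> unitary W -> desc a -> desc b -> orthant a -> orthant b ->
  X *m adj X = smx U a -> adj X *m X = smx W b -> vle b a.
Proof.
move=> hU hW da db a0 b0 ea eb i.
have ai : 0 <= a 0 i by have := a0 i; rewrite mxE.
have [bi|bi] := lerP (b 0 i) 0; first exact: le_trans bi ai.
have [y [y0 y1 y2]] := @minmax_vector n n U W X i i hW erefl.
have nX : nv (X *m y) = qv W b y.
  by apply: real_inj; rewrite -nvE adjM -qvE -eb !mulmxA.
have qX : qv U a (X *m y) = nv (smx W b *m y).
  apply: real_inj; rewrite -nvE -qvE -ea -eb !adjM adjK !mulmxA.
  by [].
have p1 : b 0 i * nv (W *m y) <= qv W b y by apply: (supp_ge y1) => l; apply: db.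
have p2 : qv U a (X *m y) <= a 0 i * qv W b y.
  by rewrite -nX -(nv_unitary (X *m y) hU); apply: (supp_le y2) => l; apply: da.
have p3 : b 0 i * qv W b y <= nv (smx W b *m y).
  have -> : nv (smx W b *m y) = \sum_j (b 0 j * b 0 j) * nsq ((W *m y) j 0).
    rewrite -(nv_unitary _ hW) /smx !mulmxA hW mul1mx -mulmxA.
    by apply: eq_bigr => j _; rewrite dm_col nsqM nsq_real.
  rewrite mulr_sumr; apply: ler_sum => j _; rewrite mulrA.
  have [ij|ij] := leqP j i; last by rewrite y1 ?nsq0 ?mulr0 // -ltnNge.
  have bij : b 0 i <= b 0 j by apply: db.
  by rewrite ler_wpM2r ?nsq_ge0 // ler_wpM2r // ltW // (lt_le_trans bi).
have q0 : 0 < qv W b y by apply: lt_le_trans p1; rewrite mulr_gt0.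
by rewrite -(ler_pM2r q0) (le_trans p3) // -qX.
Qed.

Lemma eig_swap n (X U W : 'M[C]_n) (a b : 'rV[R]_n) :
  unitary U -> unitary W -> desc a -> desc b -> orthant a -> orthant b ->
  X *m adj X = smx U a -> adj X *m X = smx W b -> a = b.
Proof.
move=> hU hW da db a0 b0 ea eb; apply/rowP => i; apply/eqP; rewrite eq_le.
rewrite (eig_swap_le hU hW da db a0 b0 ea eb) andbT.
by apply: (@eig_swap_le n (adj X) W U b a); rewrite ?adjK.
Qed.

End MinMax.

(** * Weak majorization by successive T-transforms *)

Section Majorization.
Context {R : realType} {m : nat}.
Implicit Types (x y : 'rV[R]_m) (S : 'rV[R]_m -> Prop).

(* A T-transform on the first coordinate j with [y j < x j] and an earlier i with
   [x i < y i] makes one more coordinate of y agree with x. *)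
Lemma weak_majorization S :
  (forall x (g : 'S_m), S x -> S (col_perm g x)) ->
  (forall x y (t : R), S x -> S y -> 0 <= t <= 1 -> S (t *: x + (1 - t) *: y)) ->
  (forall x y, S y -> vle x y -> S x) ->
  forall x y, desc x ->
  (forall k, \sum_(i < m | (i < k)%N) x 0 i <= \sum_(i < m | (i < k)%N) y 0 i) ->
  S y -> S x.
Proof.
move=> Sp Sc Sd x y dx.
have [N] := ubnP #|[pred i | x 0 i != y 0 i]|.
elim: N y => // N IH y; rewrite ltnS => hN hs Sy.
have [h|] := pselect (vle x y); first exact: Sd Sy h.
move=> /existsNP [j0 /negP]; rewrite -ltNge => hj0.
case: (@arg_minnP _ j0 (fun j => y 0 j < x 0 j) (fun j => nat_of_ord j) hj0).
move=> j hj jmin.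
have lej (l : 'I_m) : (l < j)%N -> x 0 l <= y 0 l.
  by move=> lj; rewrite leNgt; apply/negP => /jmin; rewrite leqNgt lj.
(* Otherwise [x] and [y] would agree before [j], and the partial sum up to and including [j] would
   be larger for [x]. *)
have [i ij hi] : exists2 i : 'I_m, (i < j)%N & x 0 i < y 0 i.
  apply: contrapT => hn; have := hs j.+1.
  rewrite (bigD1 j) //= [X in _ <= X](bigD1 j) //= leNgt => /negP; apply.
  apply: ltr_leD => //; apply: ler_sum => l /andP[lj lnj].
  have {}lj : (l < j)%N by rewrite ltn_neqAle -ltnS lj andbT.
  rewrite leNgt; apply/negP => hl; by apply: hn; exists l.
have inj : i != j by apply: contraTneq ij => ->; rewrite ltnn.
pose d := Num.min (y 0 i - x 0 i) (x 0 j - y 0 j).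
have d0 : 0 < d by rewrite lt_min !subr_gt0 hi.
have di : d <= y 0 i - x 0 i by rewrite ge_min lexx.
have dj : d <= x 0 j - y 0 j by rewrite ge_min lexx orbT.
have xij : x 0 j <= x 0 i by apply: dx; apply: ltnW.
have D0 : 0 < y 0 i - y 0 j by lra.
(* [1 - t] is the share of the transposition of [i] and [j] that moves exactly [d] from [y i] to
   [y j]. It is at most 1 because [x j <= x i] makes [y i - y j] at least the sum of the two
   gaps. *)
have [t t01 ht] : exists2 t, 0 <= t <= 1 & (1 - t) * (y 0 i - y 0 j) = d.
  have t1 : d / (y 0 i - y 0 j) <= 1 by rewrite ler_pdivrMr // mul1r; lra.
  have t2 : 0 <= d / (y 0 i - y 0 j) by rewrite divr_ge0 // ltW.
  by exists (1 - d / (y 0 i - y 0 j)); rewrite ?subKr ?divfK ?gt_eqF //; lra.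
pose y' := t *: y + (1 - t) *: col_perm (tperm i j) y.
have y'E l : y' 0 l = y 0 l + (d *+ (l == j) - d *+ (l == i)).
  rewrite !mxE; case: tpermP => [->|->|/eqP/negPf h1 /eqP/negPf h2].
  - by rewrite eqxx (negPf inj) mulr0n mulr1n -ht; ring.
  - by rewrite eqxx eq_sym (negPf inj) mulr0n mulr1n -ht; ring.
  - by rewrite h1 h2 mulr0n; ring.
have Sy' : S y' by apply: Sc => //; exact: Sp.
apply: (IH y') => //.
  apply: leq_trans hN; apply: proper_card; apply/properP; split.
    apply/fintype.subsetP => l; rewrite !inE y'E.
    have [->|_] := eqVneq l j; first by rewrite (gt_eqF hj).
    have [->|_] := eqVneq l i; first by rewrite (lt_eqF hi).
    by rewrite subrr addr0.
  have [h|h] := leP (y 0 i - x 0 i) (x 0 j - y 0 j).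
    exists i; rewrite !inE ?(lt_eqF hi) // negbK y'E (negPf inj) eqxx mulr0n mulr1n.
    by rewrite /d min_l //; apply/eqP; ring.
  exists j; rewrite !inE ?(gt_eqF hj) // negbK y'E eqxx [j == i]eq_sym.
  rewrite (negPf inj) mulr0n mulr1n.
  by rewrite /d min_r ?ltW //; apply/eqP; ring.
move=> k; have := hs k.
have -> : \sum_(l < m | (l < k)%N) y' 0 l =
    \sum_(l < m | (l < k)%N) y 0 l + (d *+ (j < k)%N - d *+ (i < k)%N).
  under eq_bigr do rewrite y'E; rewrite big_split /= sumrB; congr (_ + (_ - _)).
    rewrite (bigID (pred1 j)) /= [X in _ + X]big1 ?addr0 => [|l /andP[_ /negPf ->] //].
    have [jk|jk] := ltnP j k.
      rewrite (big_pred1 j) ?eqxx // => l /=.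
      by case: eqVneq => [->|_]; rewrite ?jk ?andbF.
    by rewrite big1 // => l /andP[+ /eqP h]; rewrite h ltnNge jk.
  rewrite (bigID (pred1 i)) /= [X in _ + X]big1 ?addr0 => [|l /andP[_ /negPf ->] //].
  have [jk|jk] := ltnP i k.
    rewrite (big_pred1 i) ?eqxx // => l /=.
    by case: eqVneq => [->|_]; rewrite ?jk ?andbF.
  by rewrite big1 // => l /andP[+ /eqP h]; rewrite h ltnNge jk.
have [ik|ik] := ltnP i k; last first.
  by rewrite ltnNge (leq_trans ik (ltnW ij)) /= subr0 addr0.
have [jk|jk] := ltnP j k; first by rewrite subrr addr0.
(* Only for [i < k <= j] has the partial sum of [y] dropped, by [d]. There every entry of [x] before
   [j] is below that of [y], and at [i] the room is at least [d]. *)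
move=> _; rewrite (bigD1 i) //= [X in _ <= X + _](bigD1 i) //=.
have : \sum_(l < m | (l < k)%N && (l != i)) x 0 l <=
       \sum_(l < m | (l < k)%N && (l != i)) y 0 l.
  by apply: ler_sum => l /andP[lk _]; apply/lej/(leq_trans lk).
rewrite mulr0n mulr1n; move: di; set A := \sum_(l < m | _) _; set B := \sum_(l < m | _) _.
by move=> *; lra.
Qed.

End Majorization.

(** * Holder concave forms and their powers *)

Section Forms.
Context {R : realType}.

(* The properties of Holder concave symmetric forms that are inherited by
   [x |-> phi (x ^ r) ^ (1/r)]. *)
Record hcform m (phi : 'rV[R]_m -> R) : Prop := HCForm {
  hc_ge0 : forall x, orthant x -> 0 <= phi x;
  hc_hom : forall x (t : R), orthant x -> 0 <= t -> phi (t *: x) = t * phi x;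
  hc_le : forall x y, orthant y -> vle y x -> phi y <= phi x;
  hc_perm : forall x (g : 'S_m), orthant x -> phi (col_perm g x) = phi x;
  hc_holder : holder_form phi;
  hc_concave : concave_form phi;
  hc_cont : forall x (e : R), orthant x -> 0 < e ->
    exists2 d, 0 < d & phi (x + const_mx d) <= phi x + e
}.

Lemma orthantP m (x : 'rV[R]_m) i : orthant x -> 0 <= x 0 i.
Proof. by move=> /(_ i); rewrite mxE. Qed.

Lemma vpowE m (x : 'rV[R]_m) c i : vpow x c 0 i = x 0 i `^ c.
Proof. by rewrite mxE. Qed.

Lemma vmulE m (x y : 'rV[R]_m) i : vmul x y 0 i = x 0 i * y 0 i.
Proof. by rewrite mxE. Qed.

Lemma orthant_le m (x y : 'rV[R]_m) : orthant x -> vle x y -> orthant y.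
Proof. by move=> hx h i; apply: le_trans (hx i) (h i). Qed.

Lemma orthant_vpow m (x : 'rV[R]_m) c : orthant (vpow x c).
Proof. by move=> i; rewrite !mxE powR_ge0. Qed.

Lemma orthant_conv m (x y : 'rV[R]_m) (t : R) : orthant x -> orthant y ->
  0 <= t <= 1 -> orthant (t *: x + (1 - t) *: y).
Proof.
move=> hx hy /andP[t0 t1] i; have hxi := orthantP i hx; have hyi := orthantP i hy.
by rewrite !mxE addr_ge0 // mulr_ge0 // subr_ge0.
Qed.

Lemma vpow_le m (x y : 'rV[R]_m) c : 0 <= c -> orthant x -> vle x y ->
  vle (vpow x c) (vpow y c).
Proof.
move=> c0 hx h i; rewrite !mxE; have := orthantP i hx; have := h i => h1 h2.
by rewrite ge0_ler_powR // nnegrE // (le_trans h2).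
Qed.

Lemma vpowM m (x : 'rV[R]_m) a b : vpow (vpow x a) b = vpow x (a * b).
Proof. by apply/rowP => i; rewrite !mxE powRrM. Qed.

Lemma vpow1 m (x : 'rV[R]_m) : orthant x -> vpow x 1 = x.
Proof. by move=> hx; apply/rowP => i; rewrite !mxE powRr1 ?orthantP. Qed.

Lemma vpowK m (x : 'rV[R]_m) a : a != 0 -> orthant x -> vpow (vpow x a) a^-1 = x.
Proof. by move=> a0 hx; rewrite vpowM mulfV // vpow1. Qed.

Lemma symform_hc m (phi : 'rV[R]_m -> R) :
  symform phi -> holder_form phi -> concave_form phi -> hcform phi.
Proof.
case=> h0 hc hh hl _ hp hol con; split => //.
  by move=> x y hy h; apply: hl => //; apply: orthant_le hy h.
move=> x e hx e0; move/subspace_continuousP: hc => /(_ x hx).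
move=> /cvgrPdist_le /(_ e e0); rewrite near_withinE => /nbhs_ballP [d /= d0 hd].
exists (d / 2); first by rewrite divr_gt0.
suff : `|phi x - phi (x + const_mx (d / 2))| <= e.
  by rewrite ler_distlC => /andP[].
apply: hd.
  split=> // i j; rewrite !mxE /ball /= opprD addrA subrr add0r normrN.
  by rewrite gtr0_norm ?divr_gt0 // ltr_pdivrMr // ltr_pMr // ltr1n.
by move=> i; rewrite !mxE addr_ge0 ?orthantP // divr_ge0 // ltW.
Qed.

Lemma powR_upper_cont (x c e : R) : 0 <= x -> 0 < c -> 0 < e ->
  exists2 d, 0 < d & (x + d) `^ c <= x `^ c + e.
Proof.
move=> x0 c0 e0; pose y := (x `^ c + e) `^ c^-1.
exists (y - x).
  rewrite subr_gt0 -[X in X < _](powRr1 x0) -(mulfV (lt0r_neq0 c0)) powRrM.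
  apply: gt0_ltr_powR; rewrite ?invr_gt0 ?nnegrE ?powR_ge0 //; last lra.
  by rewrite addr_ge0 ?powR_ge0 // ltW.
rewrite addrC subrK /y -powRrM mulVf ?gt_eqF // powRr1 //.
by rewrite addr_ge0 ?powR_ge0 // ltW.
Qed.

Lemma vpow_upper_cont m (x : 'rV[R]_m) (c e : R) : orthant x -> 0 < c -> 0 < e ->
  exists2 d, 0 < d & vle (vpow (x + const_mx d) c) (vpow x c + const_mx e).
Proof.
move=> hx c0 e0.
have /choice [f hf] : forall i, exists d, 0 < d /\ (x 0 i + d) `^ c <= x 0 i `^ c + e.
  by move=> i; have [d] := powR_upper_cont (orthantP i hx) c0 e0; exists d.
exists (\big[Num.min/1]_i f i).
  by apply: lt_bigmin => // i _; case: (hf i).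
move=> i; rewrite !mxE; apply: le_trans (hf i).2.
have xi := orthantP i hx; have fi := (hf i).1.
have m0 : 0 <= \big[Num.min/1]_i f i.
  by apply: ltW; apply: lt_bigmin => // j _; case: (hf j).
apply: ge0_ler_powR; rewrite ?nnegrE ?addr_ge0 // ?(ltW c0) ?(ltW fi) //.
by rewrite lerD2l; apply: bigmin_le_cond.
Qed.

Lemma young (a b p q : R) : 0 <= a -> 0 <= b -> 0 < p -> 0 < q -> p + q = 1 ->
  a `^ p * b `^ q <= p * a + q * b.
Proof.
move=> a0 b0 p0 q0 pq.
have := @conjugate_powR R (a `^ p) (b `^ q) p^-1 q^-1.
rewrite -!powRrM !mulfV ?gt_eqF // !powRr1 // !invrK => h.
rewrite (mulrC p) (mulrC q); apply: h; rewrite ?powR_ge0 ?invr_gt0 //.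
Qed.

(** Young's inequality [x^r z^(1-r) <= r x + (1-r) z] is the tangent bound at the mean [z], and
    averaging it over [a] and [b] leaves [z] on the right. The mean 0 is set apart since the bound
    is divided by [z^(1-r)]. *)
Lemma powR_concave (a b t r : R) : 0 <= a -> 0 <= b -> 0 <= t <= 1 -> 0 < r <= 1 ->
  t * a `^ r + (1 - t) * b `^ r <= (t * a + (1 - t) * b) `^ r.
Proof.
move=> a0 b0 /andP[t0 t1] /andP[r0]; rewrite le_eqVlt => /orP[/eqP->|r1].
  by rewrite !powRr1 // addr_ge0 // mulr_ge0 // subr_ge0.
set z := t * a + (1 - t) * b.
have z0 : 0 <= z by rewrite addr_ge0 // mulr_ge0 // subr_ge0.
have [ze|zn] := eqVneq z 0.
  have /eqP : t * a + (1 - t) * b = 0 := ze.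
  have h (u x : R) : u * x == 0 -> u * x `^ r = 0.
    by rewrite mulf_eq0 => /orP[/eqP->|/eqP->]; rewrite ?powR0 ?mul0r ?mulr0 ?gt_eqF.
  rewrite paddr_eq0 ?mulr_ge0 ?subr_ge0 // => /andP[/h-> /h->].
  by rewrite addr0 powR_ge0.
have zp : 0 < z by rewrite lt_neqAle eq_sym zn.
have k (x : R) : 0 <= x -> x `^ r * z `^ (1 - r) <= r * x + (1 - r) * z.
  by move=> x0; apply: young => //; lra.
have zr : 0 < z `^ (1 - r) by apply: powR_gt0.
have zz : z `^ r * z `^ (1 - r) = z.
  by rewrite -powRD ?zn ?implybT // addrC subrK powRr1.
rewrite -(ler_pM2r zr) zz mulrDl -!mulrA.
apply: le_trans (lerD (ler_wpM2l t0 (k _ a0)) (ler_wpM2l _ (k _ b0))) _.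
  by rewrite subr_ge0.
by rewrite /z le_eqVlt; apply/orP; left; apply/eqP; ring.
Qed.

Lemma orthantZ m (x : 'rV[R]_m) (t : R) : 0 <= t -> orthant x -> orthant (t *: x).
Proof. by move=> t0 hx i; rewrite !mxE mulr_ge0 ?orthantP. Qed.

Lemma orthant_mul m (x y : 'rV[R]_m) : orthant x -> orthant y -> orthant (vmul x y).
Proof. by move=> hx hy i; rewrite !mxE mulr_ge0 ?orthantP. Qed.

Lemma vpowZ m (x : 'rV[R]_m) (t c : R) : 0 <= t -> orthant x ->
  vpow (t *: x) c = t `^ c *: vpow x c.
Proof. by move=> t0 hx; apply/rowP => i; rewrite !mxE powRM ?orthantP. Qed.

Lemma vpow_mul m (x y : 'rV[R]_m) (c : R) : orthant x -> orthant y ->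
  vpow (vmul x y) c = vmul (vpow x c) (vpow y c).
Proof. by move=> hx hy; apply/rowP => i; rewrite !mxE powRM ?orthantP. Qed.

(** By homogeneity it suffices to look at the level set 1: with [g = t psi x + (1 - t) psi y], the
    point is [g] times the combination of [x / psi x] and [y / psi y] with first weight
    [t psi x / g]. If [psi x] or [psi y] is 0, monotonicity replaces the division. *)
Lemma quasiconcave_hom_concave m (psi : 'rV[R]_m -> R) :
  (forall x, orthant x -> 0 <= psi x) ->
  (forall x (t : R), orthant x -> 0 <= t -> psi (t *: x) = t * psi x) ->
  (forall x y, orthant y -> vle y x -> psi y <= psi x) ->
  (forall x y (t : R), orthant x -> orthant y -> 0 <= t <= 1 ->
     psi x = 1 -> psi y = 1 -> 1 <= psi (t *: x + (1 - t) *: y)) ->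
  concave_form psi.
Proof.
move=> psi_ge0 psi_hom psi_le psi_quasi x y t hx hy /andP[t0 t1].
have s0 : 0 <= 1 - t by rewrite subr_ge0.
have ex := psi_hom x _ hx; have ey := psi_hom y _ hy.
move: (psi_ge0 x hx) (psi_ge0 y hy) ex ey.
move: (psi x) (psi y) => a b a0 b0 ex ey.
have [ea|an0] := eqVneq a 0.
  rewrite ea mulr0 add0r -ey //; apply: psi_le; first exact: orthantZ.
  by move=> i; rewrite !mxE lerDr mulr_ge0 ?orthantP.
have [eb|bn0] := eqVneq b 0.
  rewrite eb mulr0 addr0 -ex //; apply: psi_le; first exact: orthantZ.
  by move=> i; rewrite !mxE lerDl mulr_ge0 ?orthantP.
have {}a0 : 0 < a by rewrite lt_neqAle eq_sym an0.
have {}b0 : 0 < b by rewrite lt_neqAle eq_sym bn0.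
have [g eg] : exists g, g = t * a + (1 - t) * b by exists (t * a + (1 - t) * b).
have h1 : 0 <= t * a by rewrite mulr_ge0 // ltW.
have h2 : 0 <= (1 - t) * b by rewrite mulr_ge0 // ltW.
have g0 : 0 < g.
  rewrite lt_neqAle eq_sym eg addr_ge0 // andbT paddr_eq0 // negb_and !mulf_eq0.
  rewrite (negPf an0) (negPf bn0) !orbF -negb_and; apply/negP => /andP[/eqP->].
  by rewrite subr0 oner_eq0.
rewrite -eg.
have th01 : 0 <= t * a / g <= 1.
  apply/andP; split; first by rewrite divr_ge0 // ltW.
  by rewrite ler_pdivrMr // mul1r eg lerDl.
have th1 : 1 - t * a / g = (1 - t) * b / g.
  by apply: (mulIf (lt0r_neq0 g0)); rewrite mulrBl !divfK ?gt_eqF // eg; ring.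
have ai0 : 0 <= a^-1 by rewrite invr_ge0 ltW.
have bi0 : 0 <= b^-1 by rewrite invr_ge0 ltW.
have hxa := orthantZ ai0 hx; have hyb := orthantZ bi0 hy.
have -> : t *: x + (1 - t) *: y =
    g *: ((t * a / g) *: (a^-1 *: x) + (1 - t * a / g) *: (b^-1 *: y)).
  rewrite th1 scalerDr !scalerA; congr (_ *: _ + _ *: _); field;
    by rewrite ?an0 ?bn0 gt_eqF.
rewrite psi_hom ?(ltW g0) //; last exact: orthant_conv.
rewrite -[X in X <= _]mulr1 ler_pM2l //.
by apply: psi_quasi; rewrite ?ex ?ey ?mulVf.
Qed.

Definition pow_form m (phi : 'rV[R]_m -> R) (r : R) (x : 'rV[R]_m) : R :=
  phi (vpow x r) `^ r^-1.

Section PowForm.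
Variables (m : nat) (phi : 'rV[R]_m -> R) (r : R).
Hypotheses (hphi : hcform phi) (hr : 0 < r <= 1).
Let psi := pow_form phi r.

Let r0 : 0 < r. Proof. by case/andP: hr. Qed.
Let rn0 : r != 0. Proof. by rewrite gt_eqF. Qed.
Let ri0 : 0 <= r^-1. Proof. by rewrite invr_ge0 ltW. Qed.
Let phip0 x : 0 <= phi (vpow x r). Proof. exact/(hc_ge0 hphi)/orthant_vpow. Qed.

Let psi_hom x (t : R) : orthant x -> 0 <= t -> psi (t *: x) = t * psi x.
Proof.
move=> hx t0; rewrite /psi /pow_form vpowZ // (hc_hom hphi) ?powR_ge0 //;
  last exact: orthant_vpow.
by rewrite powRM ?powR_ge0 // -powRrM mulfV // powRr1.
Qed.

Let psi_le x y : orthant y -> vle y x -> psi y <= psi x.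
Proof.
move=> hy h; apply: ge0_ler_powR; rewrite ?nnegrE //.
by apply: (hc_le hphi); [exact: orthant_vpow | apply: vpow_le => //; exact: ltW].
Qed.

Let psi_ge0 x : 0 <= psi x. Proof. exact: powR_ge0. Qed.

Let psiK x : psi x `^ r = phi (vpow x r).
Proof. by rewrite /psi /pow_form -powRrM mulVf // powRr1. Qed.

(** The outer power [r^-1 >= 1] is convex, so concavity does not pass through it directly. On the
    level set 1 the outer power is harmless, and concavity of [phi] and of the inner power is
    enough. *)
Let psi_concave : concave_form psi.
Proof.
apply: quasiconcave_hom_concave => // x y t hx hy t01 ex ey.
have ha : phi (vpow x r) = 1 by rewrite -psiK ex powR1.
have hb : phi (vpow y r) = 1 by rewrite -psiK ey powR1.
have one : 1 = 1 `^ r^-1 :> R by rewrite powR1.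
rewrite [X in X <= _]one /psi /pow_form; apply: ge0_ler_powR; rewrite ?nnegrE //.
have := hc_concave hphi (orthant_vpow x r) (orthant_vpow y r) t01.
rewrite ha hb !mulr1 addrC subrK => /le_trans; apply.
apply: (hc_le hphi); first by apply: orthant_conv => //; exact: orthant_vpow.
by move=> i; rewrite !mxE; apply: powR_concave => //; exact: orthantP.
Qed.

Lemma hcform_pow : hcform psi.
Proof.
split.
- by move=> x _; apply: psi_ge0.
- exact: psi_hom.
- exact: psi_le.
- move=> x g hx; rewrite /psi /pow_form; congr (_ `^ _).
  rewrite -(hc_perm hphi g (orthant_vpow x r)).
  by congr phi; apply/rowP => i; rewrite !mxE.
- move=> x y p q hx hy p1 q1 pq.
  have e z c : psi (vpow z c) `^ c^-1 = (phi (vpow (vpow z r) c) `^ c^-1) `^ r^-1.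
    by rewrite /psi /pow_form !vpowM (mulrC c) powRAC.
  have exy : psi (vpow x p) `^ p^-1 * psi (vpow y q) `^ q^-1 =
      (phi (vpow (vpow x r) p) `^ p^-1 * phi (vpow (vpow y r) q) `^ q^-1) `^ r^-1.
    rewrite (powRM _ (powR_ge0 _ _) (powR_ge0 _ _)).
    exact (f_equal2 *%R (e x p) (e y q)).
  rewrite [X in _ <= X]exy.
  apply: ge0_ler_powR; rewrite ?nnegrE ?mulr_ge0 ?powR_ge0 //.
  rewrite vpow_mul //.
  by apply: (hc_holder hphi) => //; exact: orthant_vpow.
- exact: psi_concave.
- move=> x e hx e0.
  have ri1 : 0 < r^-1 by rewrite invr_gt0.
  have [d1 d10 hd1] := powR_upper_cont (phip0 x) ri1 e0.
  have [d2 d20 hd2] := hc_cont hphi (orthant_vpow x r) d10.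
  have [d3 d30 hd3] := vpow_upper_cont hx r0 d20.
  exists d3 => //; apply: le_trans hd1.
  apply: ge0_ler_powR; rewrite ?nnegrE ?addr_ge0 ?(ltW d10) //.
  apply: le_trans hd2; apply: (hc_le hphi) => //; exact: orthant_vpow.
Qed.
End PowForm.

End Forms.

(** * Monotonicity of forms under log-majorization *)

Section LogMajorization.
Context {R : realType} {m : nat}.
Variable phi : 'rV[R]_m -> R.
Hypothesis hphi : hcform phi.
Implicit Types x y z u v : 'rV[R]_m.

Lemma holder_geometric x y (p q : R) : orthant x -> orthant y ->
  0 < p -> 0 < q -> p + q = 1 ->
  phi (vmul (vpow x p) (vpow y q)) <= phi x `^ p * phi y `^ q.
Proof.
move=> hx hy p0 q0 pq.
have h (r s : R) : 0 < r -> 0 < s -> r + s = 1 -> 1 < r^-1.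
  by move=> r0 s0 e; rewrite invf_gt1 //; lra.
have pqi : p^-1^-1 + q^-1^-1 = 1 by rewrite !invrK.
have qp : q + p = 1 by rewrite addrC.
have := hc_holder hphi (orthant_vpow x p) (orthant_vpow y q) (h _ _ p0 q0 pq)
  (h _ _ q0 p0 qp) pqi.
by rewrite (vpowK (lt0r_neq0 p0) hx) (vpowK (lt0r_neq0 q0) hy) !invrK.
Qed.

Lemma holder_young x y (p q : R) : orthant x -> orthant y ->
  0 < p -> 0 < q -> p + q = 1 ->
  phi (vmul (vpow x p) (vpow y q)) <= p * phi x + q * phi y.
Proof.
move=> hx hy p0 q0 pq; apply: le_trans (holder_geometric hx hy p0 q0 pq) _.
by apply: young => //; apply: (hc_ge0 hphi).
Qed.

Let vexp u : 'rV[R]_m := map_mx (@expR R) u.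

Let vexpE u i : vexp u 0 i = expR (u 0 i).
Proof. by rewrite mxE. Qed.

Let orthant_vexp u : orthant (vexp u).
Proof. by move=> i; rewrite !mxE expR_ge0. Qed.

(** In logarithmic coordinates convex combinations are weighted geometric means, so the Holder
    property makes the sublevel sets of [phi] convex, while the products become the sums of weak
    majorization. *)
Lemma log_majorization_gt0 x y : (forall i, 0 < x 0 i) -> (forall i, 0 < y 0 i) ->
  desc x ->
  (forall k, \prod_(i < m | (i < k)%N) x 0 i <= \prod_(i < m | (i < k)%N) y 0 i) ->
  phi x <= phi y.
Proof.
move=> x0 y0 dx hxy.
pose S z : Prop := phi (vexp z) <= phi y.
pose lnv z : 'rV[R]_m := map_mx (@ln R) z.
have lnvK z : (forall i, 0 < z 0 i) -> vexp (lnv z) = z.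
  by move=> z0; apply/rowP => i; rewrite !mxE lnK // posrE.
suff : S (lnv x) by rewrite /S lnvK.
apply: (@weak_majorization R m S _ _ _ _ (lnv y)); last by rewrite /S lnvK.
- move=> z g; rewrite /S -(hc_perm hphi g (orthant_vexp z)).
  suff -> : col_perm g (vexp z) = vexp (col_perm g z) by [].
  by apply/rowP => i; rewrite !mxE.
- move=> u v t Su Sv /andP[t0 t1].
  have [->|tn0] := eqVneq t 0; first by rewrite scale0r add0r subr0 scale1r.
  have [->|tn1] := eqVneq t 1; first by rewrite subrr scale0r addr0 scale1r.
  have {}t0 : 0 < t by rewrite lt_neqAle eq_sym tn0.
  have {}t1 : 0 < 1 - t by rewrite subr_gt0 lt_neqAle tn1.
  rewrite /S; have -> : vexp (t *: u + (1 - t) *: v) =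
      vmul (vpow (vexp u) t) (vpow (vexp v) (1 - t)).
    apply/rowP => i; rewrite [LHS]vexpE [RHS]vmulE (vpowE (vexp u)) (vpowE (vexp v)).
    rewrite !vexpE [X in expR X]mxE.
    rewrite [X in X + _]mxE [X in _ + X]mxE.
    by rewrite expRD (mulrC t (u 0 i)) (mulrC (1 - t) (v 0 i)) 2!expRM.
  have e1 : t + (1 - t) = 1 by rewrite addrC subrK.
  apply: le_trans (holder_young (orthant_vexp u) (orthant_vexp v) t0 t1 e1) _.
  have -> : phi y = t * phi y + (1 - t) * phi y by rewrite -mulrDl e1 mul1r.
  by apply: lerD; apply: ler_wpM2l => //; apply: ltW.
- move=> u v Sv huv; apply: le_trans Sv; apply: (hc_le hphi) => // i.
  by rewrite !mxE ler_expR.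
- by move=> i j ij; rewrite !mxE ler_ln ?posrE //; apply: dx.
- move=> k.
  have sumE z : (forall i, 0 < z 0 i) -> \sum_(i < m | (i < k)%N) lnv z 0 i =
      ln (\prod_(i < m | (i < k)%N) z 0 i).
    move=> z0; apply: expR_inj; rewrite expR_sum lnK ?posrE ?prodr_gt0 //.
    by apply: eq_bigr => i _; rewrite mxE lnK // posrE.
  by rewrite !sumE // ler_ln ?posrE ?prodr_gt0.
Qed.

(** Zero entries have no logarithm. So [y] is raised by [d], which costs at most [e] in [phi], and
    the zeros of [x] are raised to a floor [c] below [d] and below every positive entry of [x]. *)
Lemma log_majorization x y : orthant x -> orthant y -> desc x ->
  (forall k, \prod_(i < m | (i < k)%N) x 0 i <= \prod_(i < m | (i < k)%N) y 0 i) ->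
  phi x <= phi y.
Proof.
move=> hx hy dx hxy; apply/ler_addgt0Pr => e e0.
have [d d0 hd] := hc_cont hphi hy e0.
apply: le_trans hd.
pose c := \big[Num.min/d]_(i | 0 < x 0 i) x 0 i.
have c0 : 0 < c by apply: lt_bigmin.
have cd : c <= d by apply: bigmin_le_id.
have cx i : 0 < x 0 i -> c <= x 0 i by move=> xi; apply: bigmin_le_cond.
pose x' : 'rV[R]_m := \row_i Num.max (x 0 i) c.
pose y' : 'rV[R]_m := y + const_mx d.
apply: (@le_trans _ _ (phi x')).
  by apply: (hc_le hphi) => // i; rewrite mxE le_max lexx.
apply: (@log_majorization_gt0 x' y').
- by move=> i; rewrite mxE lt_max c0 orbT.
- by move=> i; rewrite !mxE ltr_wpDl ?orthantP.
- by move=> i j ij; rewrite !mxE; apply: le_max2; rewrite ?dx.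
have hy' i : y 0 i <= y' 0 i by rewrite !mxE lerDl ltW.
have y0 i : 0 <= y 0 i by rewrite orthantP.
have x0 i : 0 <= x 0 i by rewrite orthantP.
elim=> [|k IH]; first by rewrite !big_pred0.
have [km|mk] := ltnP k m; last first.
  have ek (z : 'rV[R]_m) :
      \prod_(i < m | (i < k.+1)%N) z 0 i = \prod_(i < m | (i < k)%N) z 0 i.
    by apply: eq_bigl => i; rewrite !(leq_trans (ltn_ord i)) // leqW.
  by rewrite !ek.
pose l := Ordinal km.
(* As [x] is decreasing, a positive entry at [l] means that the floor has changed none of the first
   [k + 1] entries. Otherwise the new factor is [c <= d], at most the entry of [y']. *)
have [xl|xl] := ltP 0 (x 0 l).
  apply: (@le_trans _ _ (\prod_(i < m | (i < k.+1)%N) x 0 i)).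
    apply: ler_prod => i ik; rewrite !mxE le_max x0 /= max_l // cx //.
    by apply: lt_le_trans xl _; apply: dx.
  apply: le_trans (hxy k.+1) _; apply: ler_prod => i _.
  by rewrite y0 hy'.
have ek (z : 'rV[R]_m) : \prod_(i < m | (i < k.+1)%N) z 0 i =
    z 0 l * \prod_(i < m | (i < k)%N) z 0 i.
  rewrite (bigD1 l) //=; congr (_ * _); apply: eq_bigl => i.
  by rewrite ltnS [in RHS]ltn_neqAle andbC.
rewrite !ek; apply: ler_pM => //.
- by rewrite mxE le_max x0.
- by apply: prodr_ge0 => i _; rewrite mxE le_max x0.
rewrite mxE max_r ?(le_trans xl) ?(ltW c0) //.
by rewrite !mxE (le_trans cd) // lerDr.
Qed.

End LogMajorization.

(** * Determinants, Horn's inequality and the matrix Holder-Young bound *)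

Section MatrixHolder.
Context {R : realType}.
Local Notation C := R[i].

Lemma psdmx_congr m k (N : 'M[C]_m) (Y : 'M[C]_(m, k)) :
  psdmx N -> psdmx (adj Y *m N *m Y).
Proof.
case=> /herm_adj hN pN; split; first by apply/herm_adj; rewrite !adjM adjK hN mulmxA.
move=> v; have := pN (Y *m v); rewrite -/(adj _) -/(adj v) adjM.
by rewrite !mulmxA.
Qed.

Lemma psdmx1 m : psdmx (1%:M : 'M[C]_m).
Proof.
split; first exact/herm_adj/adj1.
by move=> v; rewrite -/(adj v) mulmx1 nvE ler0c nv_ge0.
Qed.

Lemma psdmx_gram m k (Y : 'M[C]_(m, k)) : psdmx (adj Y *m Y).
Proof. by have := psdmx_congr Y (psdmx1 m); rewrite mulmx1. Qed.

Lemma unitary1 m : unitary (1%:M : 'M[C]_m).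
Proof. by rewrite /unitary adj1 mulmx1. Qed.

Lemma smx1 m (a : 'rV[R]_m) : smx 1%:M a = dm a.
Proof. by rewrite /smx adj1 mul1mx mulmx1. Qed.

Lemma det_smx m (U : 'M[C]_m) (a : 'rV[R]_m) : unitary U ->
  \det (smx U a) = (\prod_i a 0 i)%:C.
Proof.
move=> hU; have e : \det (adj U) * \det U = 1 by rewrite -det_mulmx unitaryKV // det1.
rewrite /smx !det_mulmx mulrAC e mul1r det_diag rmorph_prod.
by apply: eq_bigr => i _; rewrite mxE.
Qed.

Section Compression.
Variables (m k : nat) (f : 'I_k -> 'I_m) (W : 'M[C]_m).
Hypotheses (finj : injective f) (hW : unitary W).
(** The columns of [adj W] are eigenvectors of every [smx W x]; [E] embeds the span of those
    selected by [f]. *)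
Let E := colsub f (adj W).

Let adjcol : adj E = rowsub f W.
Proof. by apply/matrixP => i j; rewrite adjE !mxE conjCK. Qed.

Lemma compress_smx (x : 'rV[R]_m) : adj E *m smx W x *m E = dm (colsub f x).
Proof.
rewrite adjcol mul_rowsub_mx /E mul_rowsub_mx mulmx_colsub conj_smx //.
apply/matrixP => i j; rewrite !mxE (inj_eq finj).
by case: eqP => [->|].
Qed.

Lemma compress_isometry : adj E *m E = 1%:M.
Proof.
rewrite adjcol /E mul_rowsub_mx mulmx_colsub hW.
by apply/matrixP => i j; rewrite !mxE (inj_eq finj).
Qed.
End Compression.

Lemma singular_det0 k (X : 'M[C]_k) (z : 'cV[C]_k) :
  adj X = X -> z != 0 -> X *m z = 0 -> \det X = 0.
Proof.
move=> hX z0 Xz; apply/eqP/det0P; exists (adj z).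
  by apply: contraNneq z0 => h; rewrite -(adjK z) h; apply/eqP/matrixP => i j;
    rewrite adjE !mxE conjC0.
by rewrite -hX -adjM Xz; apply/matrixP => i j; rewrite adjE !mxE conjC0.
Qed.

Lemma smx_sqrt k (V : 'M[C]_k) (g : 'rV[R]_k) :
  unitary V -> (forall i, 0 < g 0 i) -> exists H Hi : 'M[C]_k,
  [/\ adj H = H, adj Hi = Hi, H *m H = smx V g, Hi *m H = 1%:M & H *m Hi = 1%:M].
Proof.
move=> hV gp.
have sq0 i : Num.sqrt (g 0 i) != 0 by rewrite gt_eqF // sqrtr_gt0.
pose h : 'rV[R]_k := \row_i Num.sqrt (g 0 i).
pose hi : 'rV[R]_k := \row_i (Num.sqrt (g 0 i))^-1.
have e1 : vmul h h = g.
  by apply/rowP => i; rewrite vmulE mxE -expr2 sqr_sqrtr // ltW.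
have e2 : vmul hi h = const_mx 1.
  by apply/rowP => i; rewrite vmulE [hi 0 i]mxE [h 0 i]mxE [RHS]mxE mulVf.
have e3 : vmul h hi = const_mx 1.
  by apply/rowP => i; rewrite vmulE [hi 0 i]mxE [h 0 i]mxE [RHS]mxE mulfV.
exists (smx V h), (smx V hi); split.
- exact: adj_smx.
- exact: adj_smx.
- by rewrite (smxM hV) e1.
- by rewrite (smxM hV) e2 smx_const.
- by rewrite (smxM hV) e3 smx_const.
Qed.

(** The polar decomposition [F = Q H], with [Q] an isometry and [H^2] the Gram matrix, splits the
    determinant into that of the Gram matrix and that of the compression of [smx U u] by [Q], whose
    eigenvalues interlace with [u]. *)
Lemma det_congr_le m k (U : 'M[C]_m) (u : 'rV[R]_m) (F : 'M[C]_(m, k))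
    (x g : 'rV[R]_k) (V : 'M[C]_k) (hk : (k <= m)%N) :
  unitary U -> orthant u -> desc u -> unitary V -> orthant g ->
  adj F *m smx U u *m F = dm x -> adj F *m F = smx V g ->
  \prod_i x 0 i <= (\prod_i u 0 (widen_ord hk i)) * \prod_i g 0 i.
Proof.
move=> hU u0 du hV g0 ex eg.
have u0' i : 0 <= u 0 i by rewrite orthantP.
have g0' i : 0 <= g 0 i by rewrite orthantP.
(* A zero eigenvalue of the Gram matrix gives a kernel vector of [F], and then the left side is a
   vanishing determinant. Otherwise [H] is invertible and the polar decomposition is available. *)
have [i0 /eqP gi0|gpos] := pickP (fun i => g 0 i == 0).
  pose z : 'cV[C]_k := adj V *m delta_mx i0 0.
  have z0 : z != 0.
    have : nv (V *m z) = 1.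
      rewrite /z mulmxA hV mul1mx /nv (bigD1 i0) //= big1 => [|j ji].
        by rewrite mxE !eqxx addr0 (nsq_real 1) expr1n.
      by rewrite mxE (negPf ji) /= nsq0.
    apply: contra_eq_neq => ->; rewrite mulmx0 /nv big1 => [|j _].
      by rewrite eq_sym oner_neq0.
    by rewrite mxE nsq0.
  have Fz : F *m z = 0.
    apply/eqP/negPn/negP => /nv_gt0.
    have -> : nv (F *m z) = qv V g z.
      by apply: real_inj; rewrite -nvE -qvE -eg adjM !mulmxA.
    rewrite /qv /z mulmxA hV mul1mx big1 ?ltxx // => j _.
    have [->|ji] := eqVneq j i0; first by rewrite gi0 mul0r.
    by rewrite mxE (negPf ji) nsq0 mulr0.
  have : \det (dm x) = 0.
    apply: singular_det0 (adj_dm x) z0 _.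
    by rewrite -ex -!mulmxA Fz !mulmx0.
  rewrite -(smx1 x) (det_smx _ (unitary1 k)) => /real_inj ->.
  by rewrite mulr_ge0 // prodr_ge0.
have gp i : 0 < g 0 i by rewrite lt_neqAle g0' eq_sym gpos.
have [H [Hi [aH aHi HH HiH HHi]]] := smx_sqrt hV gp.
have [Q eQ] : exists Q, Q = F *m Hi by exists (F *m Hi).
have QQ : adj Q *m Q = 1%:M.
  rewrite eQ adjM aHi mulmxA -(mulmxA Hi (adj F) F) eg -HH.
  by rewrite (mulmxA Hi H H) HiH mul1mx HHi.
have FQ : F = Q *m H by rewrite eQ -mulmxA HiH mulmx1.
have [Z [q [hZ q0 dq eq]]] := psd_dec_desc (psdmx_congr Q (psdmx_smx U u0)).
have : \det (dm x) = \det (smx V g) * \det (smx Z q).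
  have -> : dm x = H *m smx Z q *m H by rewrite -ex FQ adjM aH -eq !mulmxA.
  by rewrite -HH !det_mulmx mulrAC.
rewrite -(smx1 x) (det_smx _ (unitary1 k)) (det_smx _ hV) (det_smx _ hZ).
rewrite -(rmorphM (real_complex R)) => /real_inj ->.
rewrite mulrC ler_wpM2r ?prodr_ge0 //.
apply: ler_prod => i _; rewrite orthantP //=.
apply: (@eig_le _ _ _ U u Z q Q) => //.
- by move=> y; rewrite (qv_congr y (esym eq)).
- by move=> y; apply: nv_isometry.
Qed.

(* Horn's inequality: compressing by the top k eigenvectors of Y* N Y turns the
   product of its k largest eigenvalues into a determinant. *)
Lemma horn m (N Y U W V : 'M[C]_m) (u x v : 'rV[R]_m) :
  unitary U -> orthant u -> desc u -> unitary W -> orthant x -> desc x ->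
  unitary V -> orthant v -> desc v ->
  N = smx U u -> adj Y *m N *m Y = smx W x -> adj Y *m Y = smx V v ->
  forall k, \prod_(i < m | (i < k)%N) x 0 i <=
            \prod_(i < m | (i < k)%N) (u 0 i * v 0 i).
Proof.
move=> hU u0 du hW x0 dx hV v0 dv eN ex ev k.
wlog hk : k / (k <= m)%N.
  move=> hw; have [/hw //|/ltnW mk] := leqP k m.
  have e (z : 'I_m -> R) :
      \prod_(i < m | (i < k)%N) z i = \prod_(i < m | (i < m)%N) z i.
    by apply: eq_bigl => i; rewrite ltn_ord (leq_trans (ltn_ord i)).
  by rewrite !e; apply: hw.
have winj : injective (widen_ord hk) by move=> i j /(congr1 val) /= ij; apply: val_inj.
rewrite !(big_ord_narrow hk) big_split /=.
pose E := colsub (widen_ord hk) (adj W).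
have EE : adj E *m E = 1%:M := compress_isometry winj hW.
have [Z [g [hZ g0 dg eg]]] := psd_dec_desc (psdmx_gram (Y *m E)).
have := @det_congr_le m k U u (Y *m E) (colsub (widen_ord hk) x) g Z hk.
move=> /(_ hU u0 du hZ g0 _ eg) h.
apply: (@le_trans _ _ (\prod_i (colsub (widen_ord hk) x) 0 i)).
  by rewrite le_eqVlt; apply/orP; left; apply/eqP/eq_bigr => i _; rewrite mxE.
apply: le_trans (h _) _.
  by rewrite -(compress_smx winj hW) -/E -ex eN adjM !mulmxA.
apply: ler_wpM2l; first by apply: prodr_ge0 => i _; rewrite orthantP.
apply: ler_prod => i _; rewrite orthantP //=.
apply: (@eig_le _ _ _ V v Z g E) => //.
- move=> y; rewrite (@qv_congr _ _ _ V v Z g E) //.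
  by rewrite -eg -ev adjM !mulmxA.
- by move=> y; apply: nv_isometry.
Qed.

(** Horn's inequality log-majorizes the spectrum of [adj Y *m N *m Y] by [u v], and [(u v)^(1/s)] is
    the weighted geometric mean of [u^(1/(ps))] and [v^(1/(qs))]; this fixes the exponents on the
    right. [Y *m adj Y] may stand there because it shares its spectrum with [adj Y *m Y]. *)
Lemma form_mx_holder m (phi : 'rV[R]_m -> R) (N Y : 'M[C]_m) (s p q : R) :
  hcform phi -> psdmx N -> 0 < s -> 0 < p -> 0 < q -> p + q = 1 ->
  form_mx phi (mxpow (adj Y *m N *m Y) (1 / s)) <=
  p * form_mx phi (mxpow N (1 / (p * s))) +
  q * form_mx phi (mxpow (Y *m adj Y) (1 / (q * s))).
Proof.
move=> hphi pN s0 p0 q0 pq.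
have [U [u [hU u0 du eN]]] := psd_dec_desc pN.
have [W [x [hW x0 dx ex]]] := psd_dec_desc (psdmx_congr Y pN).
have [V [v [hV v0 dv ev]]] := psd_dec_desc (psdmx_gram Y).
have := psdmx_gram (adj Y); rewrite adjK => /psd_dec_desc [V' [v' [hV' v'0 dv' ev']]].
have evv : v' = v := eig_swap hV' hV dv' dv v'0 v0 ev' ev.
have hp := hc_perm hphi.
rewrite ex eN ev' evv !mxpow_smx // !form_mx_smx //; try exact: orthant_vpow.
apply: le_trans (holder_young hphi (orthant_vpow _ _) (orthant_vpow _ _) p0 q0 pq).
apply: (log_majorization hphi) => //.
- exact: orthant_vpow.
- by apply: orthant_mul; exact: orthant_vpow.
- move=> i j ij; rewrite !vpowE; apply: ge0_ler_powR; rewrite ?nnegrE ?orthantP //.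
    by rewrite divr_ge0 // ltW.
  exact: dx.
move=> k; set c := 1 / s.
have c0 : 0 <= c by rewrite divr_ge0 // ltW.
have prod_pow (z : 'I_m -> R) : (forall i, 0 <= z i) ->
    \prod_(i < m | (i < k)%N) z i `^ c = (\prod_(i < m | (i < k)%N) z i) `^ c.
  move=> z0.
  suff [] : 0 <= \prod_(i < m | (i < k)%N) z i /\ \prod_(i < m | (i < k)%N) z i `^ c =
      (\prod_(i < m | (i < k)%N) z i) `^ c by [].
  apply: (big_ind2 (fun a b : R => 0 <= b /\ a = b `^ c)).
  - by rewrite powR1.
  - by move=> a a' b b' [a0 ->] [b0 ->]; rewrite mulr_ge0 // powRM.
  - by move=> i _; split.
have u0' i := orthantP i u0; have v0' i := orthantP i v0; have x0' i := orthantP i x0.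
have sn0 : s != 0 by rewrite gt_eqF.
have pn0 : p != 0 by rewrite gt_eqF.
have qn0 : q != 0 by rewrite gt_eqF.
have ep : 1 / (p * s) * p = c by rewrite /c; field; rewrite sn0 pn0.
have eq : 1 / (q * s) * q = c by rewrite /c; field; rewrite sn0 qn0.
have euv i : vmul (vpow (vpow u (1 / (p * s))) p) (vpow (vpow v (1 / (q * s))) q) 0 i =
    (u 0 i * v 0 i) `^ c.
  by rewrite !vpowM ep eq powRM // vmulE !vpowE.
rewrite (eq_bigr (fun i => x 0 i `^ c)); last by move=> i _; rewrite vpowE.
rewrite [X in _ <= X](eq_bigr (fun i => (u 0 i * v 0 i) `^ c)); last by move=> i _.
rewrite !prod_pow //; last by move=> i; rewrite mulr_ge0.
apply: ge0_ler_powR; rewrite ?nnegrE ?prodr_ge0 //.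
  by move=> i _; rewrite mulr_ge0.
exact: horn hU u0 du hW x0 dx hV v0 dv eN ex ev k.
Qed.

End MatrixHolder.

(** * Stability properties of jointly concave functions of left and right multiplication *)

Section Lieb.
Context {R : realType}.
Local Notation C := R[i].
Implicit Types g h : R -> R -> R.

Definition lform g n m (U : 'M[C]_n) (a : 'rV[R]_n) (W : 'M[C]_m) (b : 'rV[R]_m)
    (K : 'M[C]_(n, m)) : R :=
  \sum_i \sum_j g (a 0 i) (b 0 j) * nsq ((U *m K *m adj W) i j).

Definition convmx n (t : R) (U U1 U2 : 'M[C]_n) (a a1 a2 : 'rV[R]_n) : Prop :=
  [/\ unitary U /\ orthant a, unitary U1 /\ orthant a1, unitary U2 /\ orthant a2 &
      smx U a = t%:C *: smx U1 a1 + (1 - t)%:C *: smx U2 a2].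

(* [lform g] is the quadratic form of [g] applied to the commuting operators of
   left multiplication by A and right multiplication by B. *)
Definition lieb_concave g : Prop := forall n m (t : R)
  (U U1 U2 : 'M[C]_n) (a a1 a2 : 'rV[R]_n)
  (W W1 W2 : 'M[C]_m) (b b1 b2 : 'rV[R]_m) (K : 'M[C]_(n, m)), 0 <= t <= 1 ->
  convmx t U U1 U2 a a1 a2 -> convmx t W W1 W2 b b1 b2 ->
  t * lform g U1 a1 W1 b1 K + (1 - t) * lform g U2 a2 W2 b2 K <= lform g U a W b K.

Lemma lform_ext g h n m (U : 'M[C]_n) (a : 'rV[R]_n) (W : 'M[C]_m) (b : 'rV[R]_m) K :
  (forall x y, 0 <= x -> 0 <= y -> g x y = h x y) -> orthant a -> orthant b ->
  lform g U a W b K = lform h U a W b K.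
Proof.
move=> e a0 b0; apply: eq_bigr => i _; apply: eq_bigr => j _.
by rewrite e ?orthantP.
Qed.

Lemma lieb_ext g h : (forall x y, 0 <= x -> 0 <= y -> g x y = h x y) ->
  lieb_concave g -> lieb_concave h.
Proof.
move=> e hg n m t U U1 U2 a a1 a2 W W1 W2 b b1 b2 K t01 ca cb.
have [[_ a0] [_ a10] [_ a20] _] := ca; have [[_ b0] [_ b10] [_ b20] _] := cb.
by rewrite -!(lform_ext _ _ _ e) //; apply: hg ca cb.
Qed.

Lemma row_nv_unitary n m (X : 'M[C]_(n, m)) (W : 'M[C]_m) i : unitary W ->
  \sum_j nsq ((X *m adj W) i j) = \sum_j nsq (X i j).
Proof.
move=> hW.
have e k (Y : 'M[C]_(n, k)) : (\sum_j nsq (Y i j))%:C = (Y *m adj Y) i i.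
  by rewrite mxE rmorph_sum; apply: eq_bigr => j _; rewrite adjE mulrC /= nsqE.
apply: real_inj; rewrite !e adjM adjK mulmxA -(mulmxA X) unitaryKV //.
by rewrite mulmx1.
Qed.

Lemma lform_left n m (U : 'M[C]_n) (a : 'rV[R]_n) (W : 'M[C]_m) (b : 'rV[R]_m) K :
  unitary W -> lform (fun x _ => x) U a W b K = \sum_j qv U a (col j K).
Proof.
move=> hW; rewrite /lform.
under eq_bigr do rewrite -mulr_sumr row_nv_unitary // mulr_sumr.
rewrite exchange_big; apply: eq_bigr => j _ /=.
apply: eq_bigr => i _.
have -> // : (U *m col j K) i 0 = (U *m K) i j.
by rewrite !mxE; apply: eq_bigr => l _; rewrite mxE.
Qed.

Lemma qv_conv n (t : R) (U U1 U2 : 'M[C]_n) (a a1 a2 : 'rV[R]_n) y :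
  convmx t U U1 U2 a a1 a2 -> qv U a y = t * qv U1 a1 y + (1 - t) * qv U2 a2 y.
Proof.
case=> _ _ _ e; apply: real_inj.
rewrite [RHS](rmorphD (real_complex R)) 2!(rmorphM (real_complex R)) /= -!qvE e.
rewrite mulmxDr mulmxDl -!scalemxAr -!scalemxAl mxE.
by congr (_ + _); apply: mxE.
Qed.

Lemma lform_swap g n m (U : 'M[C]_n) (a : 'rV[R]_n) (W : 'M[C]_m) (b : 'rV[R]_m) K :
  lform g U a W b K = lform (fun x y => g y x) W b U a (adj K).
Proof.
rewrite /lform exchange_big; apply: eq_bigr => j _; apply: eq_bigr => i _.
by rewrite -[X in _ = _ * nsq X]conjCK nsq_conj -adjE !adjM !adjK mulmxA.
Qed.

(** This form is linear in [A], so equality holds. Together with its mirror image it is the seed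
    from which all the powers are generated. *)
Lemma lieb_left : lieb_concave (fun x _ => x).
Proof.
move=> n m t U U1 U2 a a1 a2 W W1 W2 b b1 b2 K _ ca [[hW _] [hW1 _] [hW2 _] _].
rewrite (lform_left _ _ _ _ hW) (lform_left _ _ _ _ hW1) (lform_left _ _ _ _ hW2).
rewrite 2!mulr_sumr -big_split /=.
by apply: ler_sum => j _; rewrite (qv_conv _ ca).
Qed.

Lemma lieb_swap g : lieb_concave g -> lieb_concave (fun x y => g y x).
Proof.
move=> hg n m t U U1 U2 a a1 a2 W W1 W2 b b1 b2 K t01 ca cb.
by rewrite !(@lform_swap (fun x y => g y x)); apply: hg t01 cb ca.
Qed.

Lemma lieb_right : lieb_concave (fun _ y => y).
Proof. exact: (lieb_swap lieb_left). Qed.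

Lemma lformD g h n m (U : 'M[C]_n) (a : 'rV[R]_n) (W : 'M[C]_m) (b : 'rV[R]_m) K :
  lform (fun x y => g x y + h x y) U a W b K = lform g U a W b K + lform h U a W b K.
Proof.
rewrite /lform -big_split; apply: eq_bigr => i _; rewrite -big_split.
by apply: eq_bigr => j _; rewrite mulrDl.
Qed.

Lemma lformZ c g n m (U : 'M[C]_n) (a : 'rV[R]_n) (W : 'M[C]_m) (b : 'rV[R]_m) K :
  lform (fun x y => c * g x y) U a W b K = c * lform g U a W b K.
Proof.
rewrite /lform mulr_sumr; apply: eq_bigr => i _; rewrite mulr_sumr.
by apply: eq_bigr => j _; rewrite mulrA.
Qed.

Lemma liebD g h : lieb_concave g -> lieb_concave h ->
  lieb_concave (fun x y => g x y + h x y).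
Proof.
move=> hg hh n m t U U1 U2 a a1 a2 W W1 W2 b b1 b2 K t01 ca cb.
rewrite 3!lformD 2!mulrDr addrACA.
by apply: lerD; [apply: hg t01 ca cb | apply: hh t01 ca cb].
Qed.

Lemma liebZ c g : 0 <= c -> lieb_concave g -> lieb_concave (fun x y => c * g x y).
Proof.
move=> c0 hg n m t U U1 U2 a a1 a2 W W1 W2 b b1 b2 K t01 ca cb.
rewrite 3!lformZ mulrCA [X in _ + X]mulrCA -mulrDr ler_wpM2l //.
by apply: hg t01 ca cb.
Qed.

(** Multiplied by [u + v], the difference of the two sides is [|u z - v w|^2]. When [u + v = 0], the
    convention on division makes the left side 0. *)
Lemma nsqD_parallel (u v : R) (z w : C) : 0 <= u -> 0 <= v ->
  u * v / (u + v) * nsq (z + w) <= u * nsq z + v * nsq w.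
Proof.
move=> u0 v0; have [e|ne] := eqVneq (u + v) 0.
  rewrite e invr0 mulr0 mul0r addr_ge0 // mulr_ge0 // nsq_ge0 //.
have p : 0 < u + v by rewrite lt_neqAle eq_sym ne addr_ge0.
rewrite mulrAC ler_pdivrMr // -subr_ge0.
case: z => z1 z2; case: w => w1 w2; rewrite /nsq /=.
have -> : (u * (z1 ^+ 2 + z2 ^+ 2) + v * (w1 ^+ 2 + w2 ^+ 2)) * (u + v) -
    u * v * ((z1 + w1) ^+ 2 + (z2 + w2) ^+ 2) =
    (u * z1 - v * w1) ^+ 2 + (u * z2 - v * w2) ^+ 2 by ring.
by rewrite addr_ge0 ?sqr_ge0.
Qed.

(* The parallel sum is an infimum of joint quadratic forms over K = K1 + K2. *)
Lemma lieb_parallel g h :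
  (forall x y, 0 <= x -> 0 <= y -> 0 <= g x y) ->
  (forall x y, 0 <= x -> 0 <= y -> 0 <= h x y) ->
  lieb_concave g -> lieb_concave h ->
  lieb_concave (fun x y => g x y * h x y / (g x y + h x y)).
Proof.
move=> g0 h0 hg hh n m t U U1 U2 a a1 a2 W W1 W2 b b1 b2 K t01 ca cb.
have [[hU a0] [_ a10] [_ a20] _] := ca; have [[hW b0] [_ b10] [_ b20] _] := cb.
have /andP[t0 t1] := t01.
pose M := U *m K *m adj W.
(* The optimal splitting at the intermediate point: in its eigenbases [K2] receives the share
   [g / (g + h)] of each entry and [K1] the rest. At the end points the same splitting is only a
   competitor, which is the direction required. *)
pose T := \matrix_(i, j) ((g (a 0 i) (b 0 j) /
  (g (a 0 i) (b 0 j) + h (a 0 i) (b 0 j)))%:C * M i j).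
pose K2 := adj U *m T *m W; pose K1 := K - K2.
have eK2 : U *m K2 *m adj W = T.
  by rewrite /K2 !mulmxA hU mul1mx -mulmxA hW mulmx1.
have eK1 : U *m K1 *m adj W = M - T.
  by rewrite -eK2 /K1 mulmxBr mulmxBl.
have up : lform g U a W b K1 + lform h U a W b K2 <=
    lform (fun x y => g x y * h x y / (g x y + h x y)) U a W b K.
  rewrite /lform -big_split; apply: ler_sum => i _; rewrite -big_split.
  apply: ler_sum => j _ /=; rewrite eK1 eK2 mxE [(- T) i j]mxE [T i j]mxE -/M.
  have := g0 _ _ (orthantP i a0) (orthantP j b0).
  have := h0 _ _ (orthantP i a0) (orthantP j b0).
  move: (g _ _) (h _ _) (M i j) => u v z v0 u0.
  have -> : z - (u / (u + v))%:C * z = (1 - u / (u + v))%:C * z.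
    by rewrite rmorphB mulrBl mul1r.
  rewrite !nsqM !nsq_real !mulrA -mulrDl ler_wpM2r ?nsq_ge0 //.
  have [e|ne] := eqVneq (u + v) 0.
    have [-> ->] : u = 0 /\ v = 0 by split; lra.
    by rewrite !mul0r addr0.
  by rewrite le_eqVlt; apply/orP; left; apply/eqP; field.
have down V c X d : orthant c -> orthant d ->
    lform (fun x y => g x y * h x y / (g x y + h x y)) V c X d K <=
    lform g V c X d K1 + lform h V c X d K2.
  move=> c0 d0.
  have eK : V *m K *m adj X = V *m K1 *m adj X + V *m K2 *m adj X.
    by rewrite -mulmxDl -mulmxDr /K1 subrK.
  rewrite /lform -big_split; apply: ler_sum => i _; rewrite -big_split.
  apply: ler_sum => j _ /=; rewrite eK [(V *m K1 *m adj X + V *m K2 *m adj X) i j]mxE.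
  by apply: nsqD_parallel; [apply: g0|apply: h0]; rewrite orthantP.
apply: le_trans up.
have s0 : 0 <= 1 - t by rewrite subr_ge0.
apply: le_trans (lerD (ler_wpM2l t0 (down U1 a1 W1 b1 a10 b10))
  (ler_wpM2l s0 (down U2 a2 W2 b2 a20 b20))) _.
rewrite 2!mulrDr addrACA.
by apply: lerD; [apply: hg t01 ca cb | apply: hh t01 ca cb].
Qed.

End Lieb.

(** * Geometric means, and Lieb's theorem by bisection of the exponent *)

Section LiebPowers.
Context {R : realType}.
Local Notation C := R[i].
Implicit Types g h : R -> R -> R.

Lemma cvg_dyadic (u : nat -> R) (l c : R) :
  (forall k, `|l - u k| <= c / 2 ^+ k) -> u @ \oo --> l.
Proof.
move=> hu; apply/cvgrPdist_le => e e0.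
have c0 : 0 <= c.
  by have := hu 0%N; rewrite expr0 divr1; apply: le_trans; apply: normr_ge0.
have d0 : 0 < e / (c + 1) by rewrite divr_gt0 // ltr_wpDl.
have := near_infty_natSinv_expn_lt (PosNum d0).
apply: filterS => k /= hk; apply: le_trans (hu k) _.
have c1 : 0 < c + 1 by rewrite ltr_wpDl.
move: hk; rewrite ltr_pdivlMr // => /ltW; apply: le_trans.
by rewrite div1r mulrC ler_wpM2l ?invr_ge0 ?exprn_ge0 // lerDl.
Qed.

Lemma cvg_big_sum (I : Type) (s : seq I) (f : I -> nat -> R) (l : I -> R) :
  (forall i, f i @ \oo --> l i) ->
  (fun k => \sum_(i <- s) f i k) @ \oo --> \sum_(i <- s) l i.
Proof.
move=> hf; elim: s => [|i s IH].
  under eq_fun do rewrite big_nil; rewrite big_nil; exact: cvg_cst.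
under eq_fun do rewrite big_cons; rewrite big_cons; exact: cvgD (hf i) IH.
Qed.

Lemma lieb_lim (h : nat -> R -> R -> R) g :
  (forall k, lieb_concave (h k)) ->
  (forall x y, 0 <= x -> 0 <= y -> (fun k => h k x y) @ \oo --> g x y) ->
  lieb_concave g.
Proof.
move=> hh hg n m t U U1 U2 a a1 a2 W W1 W2 b b1 b2 K t01 ca cb.
have [[_ a0] [_ a10] [_ a20] _] := ca; have [[_ b0] [_ b10] [_ b20] _] := cb.
have lc V c X d : orthant c -> orthant d ->
    (fun k => lform (h k) V c X d K) @ \oo --> lform g V c X d K.
  move=> c0 d0; apply: cvg_big_sum => i; apply: cvg_big_sum => j.
  by apply: cvgMr_tmp; apply: hg; apply: orthantP.
have l1 := cvgMl_tmp (a := t) (lc U1 a1 W1 b1 a10 b10).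
have l2 := cvgMl_tmp (a := 1 - t) (lc U2 a2 W2 b2 a20 b20).
apply: (ler_cvg_to (cvgD (l1 _) (l2 _)) (lc U a W b a0 b0)).
by apply: nearW => k /=; apply: hh t01 ca cb.
Qed.

(** The arithmetic-harmonic iteration, made of sums, scalings and parallel sums only. Its product is
    invariant, so both sequences tend to the geometric mean. *)
Fixpoint agm g h k : (R -> R -> R) * (R -> R -> R) :=
  if k is k'.+1 then let: (u, v) := agm g h k' in
    (fun x y => 2^-1 * (u x y + v x y),
     fun x y => 2 * (u x y * v x y / (u x y + v x y)))
  else (g, h).

(** The new gap is [(u - v)^2 / (2 (u + v))], and [|u - v| <= u + v]; hence it is at most half the
    old one. *)
Lemma agm_step (u v : R) : 0 <= u -> 0 <= v ->
  let u' := 2^-1 * (u + v) in let v' := 2 * (u * v / (u + v)) in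
  [/\ 0 <= u', 0 <= v', u' * v' = u * v & `|u' - v'| <= 2^-1 * `|u - v|].
Proof.
move=> u0 v0 /=; have [e|ne] := eqVneq (u + v) 0.
  have [-> ->] : u = 0 /\ v = 0 by split; lra.
  by rewrite !(mulr0, mul0r, addr0, subr0, normr0).
have p : 0 < u + v by rewrite lt_neqAle eq_sym ne addr_ge0.
split.
- by rewrite mulr_ge0 ?addr_ge0.
- by rewrite mulr_ge0 // divr_ge0 ?mulr_ge0 ?addr_ge0.
- by field.
have -> : 2^-1 * (u + v) - 2 * (u * v / (u + v)) = 2^-1 * (u - v) * ((u - v) / (u + v)).
  by field.
rewrite !normrM !normfV (ger0_norm (ltW p)) (@ger0_norm _ 2) //.
rewrite -[X in _ <= X]mulr1; apply: ler_wpM2l; first by rewrite mulr_ge0.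
by rewrite ler_pdivrMr // mul1r ler_norml; apply/andP; split; lra.
Qed.

Lemma agm_prop g h x y k : 0 <= g x y -> 0 <= h x y ->
  [/\ 0 <= (agm g h k).1 x y, 0 <= (agm g h k).2 x y,
   (agm g h k).1 x y * (agm g h k).2 x y = g x y * h x y &
   `|(agm g h k).1 x y - (agm g h k).2 x y| <= `|g x y - h x y| / 2 ^+ k].
Proof.
move=> g0 h0; elim: k => [|k]; first by rewrite expr0 divr1.
rewrite /=; case: (agm g h k) => u v /= [u0 v0 e d].
have [u'0 v'0 e' d'] := agm_step u0 v0; split => //; first by rewrite e'.
apply: le_trans d' _; rewrite exprS invfM mulrCA.
by rewrite ler_wpM2l ?invr_ge0.
Qed.

Lemma lieb_geometric g h :
  (forall x y, 0 <= x -> 0 <= y -> 0 <= g x y) ->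
  (forall x y, 0 <= x -> 0 <= y -> 0 <= h x y) ->
  lieb_concave g -> lieb_concave h ->
  lieb_concave (fun x y => Num.sqrt (g x y * h x y)).
Proof.
move=> g0 h0 hg hh; apply: (@lieb_lim (fun k => (agm g h k).1)); last first.
  move=> x y x0 y0; apply: (@cvg_dyadic _ _ `|g x y - h x y|) => k.
  have [] := agm_prop k (g0 x y x0 y0) (h0 x y x0 y0).
  move: ((agm g h k).1 x y) ((agm g h k).2 x y) => u v u0 v0 <- d.
  (* The invariant product places the limit between the two iterates, so their gap bounds the
     error. *)
  apply: le_trans d.
  have [uv|vu] := leP u v.
    have lo : u <= Num.sqrt (u * v).
      by rewrite -{1}(ger0_norm u0) -sqrtr_sqr ler_wsqrtr // expr2 ler_wpM2l.
    have hi : Num.sqrt (u * v) <= v.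
      by rewrite -{2}(ger0_norm v0) -sqrtr_sqr ler_wsqrtr // expr2 ler_wpM2r.
    by rewrite ger0_norm ?subr_ge0 // distrC ger0_norm ?subr_ge0 // lerD2r.
  have {}vu := ltW vu.
  have lo : v <= Num.sqrt (u * v).
    by rewrite -{1}(ger0_norm v0) -sqrtr_sqr ler_wsqrtr // expr2 ler_wpM2r.
  have hi : Num.sqrt (u * v) <= u.
    by rewrite -{2}(ger0_norm u0) -sqrtr_sqr ler_wsqrtr // expr2 ler_wpM2l.
  by rewrite distrC ger0_norm ?subr_ge0 // ger0_norm ?subr_ge0 // lerD2l lerN2.
move=> k; suff [] : lieb_concave (agm g h k).1 /\ lieb_concave (agm g h k).2 by [].
elim: k => // k.
have p1 x y (x0 : 0 <= x) (y0 : 0 <= y) : 0 <= (agm g h k).1 x y.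
  by have [] := agm_prop k (g0 x y x0 y0) (h0 x y x0 y0).
have p2 x y (x0 : 0 <= x) (y0 : 0 <= y) : 0 <= (agm g h k).2 x y.
  by have [] := agm_prop k (g0 x y x0 y0) (h0 x y x0 y0).
rewrite /=; case: (agm g h k) p1 p2 => u v /= p1 p2 [hu hv]; split.
  by apply: liebZ; [rewrite invr_ge0 | apply: liebD].
by apply: liebZ => //; apply: lieb_parallel.
Qed.

Lemma powRD_ge0 (x r s : R) : 0 <= r -> 0 <= s -> x `^ (r + s) = x `^ r * x `^ s.
Proof.
move=> r0 s0; have [/eqP|ne] := eqVneq (r + s) 0; last by rewrite powRD // (negPf ne).
rewrite paddr_eq0 // => /andP[/eqP -> /eqP ->].
by rewrite addr0 !powRr0 mulr1.
Qed.

Let pw (r x y : R) : R := x `^ r * y `^ (1 - r).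

Lemma lieb_pow_mid (r s : R) : 0 <= r <= 1 -> 0 <= s <= 1 ->
  lieb_concave (pw r) -> lieb_concave (pw s) -> lieb_concave (pw ((r + s) / 2)).
Proof.
move=> /andP[r0 r1] /andP[s0 s1] hr hs.
have pw0 c x y : 0 <= pw c x y by rewrite mulr_ge0 // powR_ge0.
apply: lieb_ext (lieb_geometric _ _ hr hs) => // x y x0 y0.
have e1 : x `^ ((r + s) / 2) = (x `^ r * x `^ s) `^ 2^-1 by rewrite powRrM powRD_ge0.
have e2 : y `^ (1 - (r + s) / 2) = (y `^ (1 - r) * y `^ (1 - s)) `^ 2^-1.
  by rewrite -powRD_ge0 ?subr_ge0 // -powRrM; congr powR; field.
rewrite /pw e1 e2 -powRM ?mulr_ge0 ?powR_ge0 // powR12_sqrt ?mulr_ge0 ?powR_ge0 //.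
by congr Num.sqrt; ring.
Qed.

(** Bisection from the linear cases, exponents 0 and 1: the geometric mean of two powers is the
    power at the midpoint of the exponents. *)
Lemma lieb_dyadic (r : R) k : 0 <= r <= 1 -> exists l u : R,
  [/\ lieb_concave (pw l) /\ lieb_concave (pw u), 0 <= l, l <= r <= u, u <= 1
    & u - l = 1 / 2 ^+ k].
Proof.
move=> r01; elim: k => [|k [l [u [[hl hu] l0 /andP[lr ru] u1 e]]]].
  exists 0, 1; rewrite subr0 expr0 divr1; split => //; split.
    apply: lieb_ext lieb_right => x y x0 y0.
    by rewrite /pw powRr0 subr0 powRr1 // mul1r.
  apply: lieb_ext lieb_left => x y x0 y0.
  by rewrite /pw subrr powRr0 powRr1 // mulr1.
have hm : lieb_concave (pw ((l + u) / 2)) by apply: lieb_pow_mid => //; lra.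
have ek : 1 / 2 ^+ k.+1 = (u - l) / 2 by rewrite e exprS invfM !mul1r mulrC.
have [rm|mr] := leP r ((l + u) / 2).
  by exists l, ((l + u) / 2); rewrite ek; split => //; lra.
by exists ((l + u) / 2), u; rewrite ek; split => //; lra.
Qed.

Lemma lieb_pow (r : R) : 0 < r < 1 -> lieb_concave (fun x y => x `^ r * y `^ (1 - r)).
Proof.
move=> /andP[r0 r1].
have /choice [f hf] : forall k, exists c, [/\ lieb_concave (pw c), 0 < c < 1 &
    `|r - c| <= 1 / 2 ^+ k].
  move=> k; have [|l [u [[hl hu] l0 /andP[lr ru] u1 e]]] := @lieb_dyadic r k.
    by rewrite !ltW.
  have kp : (0 : R) < 1 / 2 ^+ k by rewrite divr_gt0 // exprn_gt0.
  (* The midpoint lies strictly between 0 and 1, unlike possibly [l] and [u]. At a vanishing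
     eigenvalue all terms of the sequence are then 0, like the limit, whereas the exponent 0 would
     give 1. *)
  exists ((l + u) / 2); split; first by apply: lieb_pow_mid => //; lra.
    by apply/andP; split; lra.
  by rewrite ler_norml; apply/andP; split; lra.
apply: (@lieb_lim (fun k => pw (f k))) => [k|x y x0 y0]; first by case: (hf k).
have cf : f @ \oo --> r by apply: (@cvg_dyadic _ _ 1) => k; case: (hf k).
have [ex|xn] := eqVneq x 0.
  rewrite /pw ex powR0 ?gt_eqF // mul0r (_ : (fun k => _) = fun=> 0);
    first exact: cvg_cst.
  apply/funext => k; have [_ /andP[f0 _] _] := hf k.
  by rewrite powR0 ?gt_eqF // mul0r.
have [ey|yn] := eqVneq y 0.
  rewrite /pw ey powR0 ?subr_eq0 ?gt_eqF // mulr0 (_ : (fun k => _) = fun=> 0);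
    first exact: cvg_cst.
  apply/funext => k; have [_ /andP[_ f1] _] := hf k.
  by rewrite powR0 ?subr_eq0 ?gt_eqF // mulr0.
have e c : pw c x y = expR (c * ln x + (1 - c) * ln y).
  by rewrite /pw /powR (negPf xn) (negPf yn) expRD.
rewrite -[X in _ --> X]/(pw r x y) e; under eq_fun do rewrite e.
apply: continuous_cvg; first exact: continuous_expR.
apply: cvgD; first exact: cvgMr_tmp.
by apply: cvgMr_tmp; apply: cvgB => //; exact: cvg_cst.
Qed.

End LiebPowers.

(** * Concavity of the trace of [(adj K A^r K)^(1/r)] *)

Section Epstein.
Context {R : realType}.
Local Notation C := R[i].

Lemma psdmx_conv n (A B : 'M[C]_n) (t : R) : psdmx A -> psdmx B -> 0 <= t <= 1 ->
  psdmx (t%:C *: A + (1 - t)%:C *: B).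
Proof.
move=> [/herm_adj hA pA] [/herm_adj hB pB] /andP[t0 t1]; split.
  by apply/herm_adj; rewrite adjD !adjZ !conjC_real hA hB.
move=> v; have := pA v; have := pB v; rewrite -/(adj v).
rewrite mulmxDr mulmxDl -!scalemxAr -!scalemxAl => pB' pA'.
rewrite mxE; apply: addr_ge0.
  by rewrite [X in _ <= X]mxE mulr_ge0 // ler0c.
by rewrite [X in _ <= X]mxE mulr_ge0 // ler0c subr_ge0.
Qed.

Lemma row_nv1 n (W : 'M[C]_n) i : unitary W -> \sum_j nsq (W i j) = 1.
Proof.
move=> hW; rewrite -[W]adjK -[adj (adj W)]mul1mx row_nv_unitary; last exact: adj_unitary.
rewrite (bigD1 i) //= big1 => [|j ji]; rewrite mxE ?eqxx ?addr0.
  by rewrite (nsq_real 1) expr1n.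
by rewrite eq_sym (negPf ji) nsq0.
Qed.

Lemma col_nv1 n (W : 'M[C]_n) j : unitary W -> \sum_i nsq (W i j) = 1.
Proof.
move=> hW; rewrite -(row_nv1 j (adj_unitary hW)); apply: eq_bigr => i _.
by rewrite adjE nsq_conj.
Qed.

Lemma sum_qv n (W : 'M[C]_n) (z : 'rV[R]_n) : unitary W ->
  \sum_i qv W z (delta_mx i 0) = \sum_j z 0 j.
Proof.
move=> hW; rewrite exchange_big; apply: eq_bigr => j _ /=.
rewrite -mulr_sumr -[X in _ = X]mulr1 -(row_nv1 j hW); congr (_ * _).
by apply: eq_bigr => i _; rewrite -colE mxE.
Qed.

Lemma sum_conv n (t : R) (U U1 U2 : 'M[C]_n) (a a1 a2 : 'rV[R]_n) :
  convmx t U U1 U2 a a1 a2 ->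
  \sum_j a 0 j = t * (\sum_j a1 0 j) + (1 - t) * (\sum_j a2 0 j).
Proof.
move=> ca; have [[hU _] [hU1 _] [hU2 _] _] := ca.
rewrite -(sum_qv a hU) -(sum_qv a1 hU1) -(sum_qv a2 hU2) 2!mulr_sumr -big_split.
by apply: eq_bigr => i _; rewrite (qv_conv _ ca).
Qed.

(** Both sides are [Tr (adj K A^r K Z^(1-r))]; the right one is written in the eigenbases of
    [adj K A^r K] and of [Z]. *)
Lemma lform_pow n k (r : R) (U : 'M[C]_n) (a : 'rV[R]_n) (W V : 'M[C]_k)
    (z b : 'rV[R]_k) (K : 'M[C]_(n, k)) :
  adj K *m smx U (vpow a r) *m K = smx V b ->
  lform (fun x y => x `^ r * y `^ (1 - r)) U a W z K =
  \sum_j z 0 j `^ (1 - r) * \sum_l b 0 l * nsq ((V *m adj W) l j).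
Proof.
move=> e; rewrite /lform exchange_big; apply: eq_bigr => j _ /=.
have := qv_congr (col j (adj W)) (esym e); rewrite /qv => h.
have hc p (X : 'M[C]_(p, k)) i : (X *m col j (adj W)) i 0 = (X *m adj W) i j.
  by rewrite !mxE; apply: eq_bigr => l _; rewrite mxE.
under [in RHS]eq_bigr do rewrite -hc; rewrite h mulr_sumr.
apply: eq_bigr => i _; rewrite vpowE mulmxA hc.
by rewrite mulrCA mulrA.
Qed.

(** For [N = adj K A^r K], Young's inequality reads [Tr (N Z^(1-r)) <= r Tr N^(1/r) + (1-r) Tr Z],
    with equality at [Z = N^(1/r)]. Lieb's theorem is applied with the optimal [Z] at the end points
    and with their combination in between. The trace of that combination is the left side of the
    claim, so it cancels up to a factor [r]. *)
Lemma trace_epstein n k (t r : R) (U U1 U2 : 'M[C]_n) (a a1 a2 : 'rV[R]_n)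
    (K : 'M[C]_(n, k)) (W W1 W2 : 'M[C]_k) (b b1 b2 : 'rV[R]_k) :
  0 <= t <= 1 -> 0 < r < 1 -> convmx t U U1 U2 a a1 a2 ->
  unitary W -> unitary W1 -> unitary W2 -> orthant b -> orthant b1 -> orthant b2 ->
  adj K *m smx U (vpow a r) *m K = smx W b ->
  adj K *m smx U1 (vpow a1 r) *m K = smx W1 b1 ->
  adj K *m smx U2 (vpow a2 r) *m K = smx W2 b2 ->
  t * (\sum_j b1 0 j `^ r^-1) + (1 - t) * (\sum_j b2 0 j `^ r^-1) <=
  \sum_j b 0 j `^ r^-1.
Proof.
move=> t01 r01 ca hW hW1 hW2 b0 b10 b20 eb eb1 eb2.
have /andP[r0 r1] := r01.
have rn0 : r != 0 by rewrite gt_eqF.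
have o1 := orthant_vpow b1 r^-1; have o2 := orthant_vpow b2 r^-1.
have [V [z [hV z0 ez]]] := psd_dec (psdmx_conv (psdmx_smx W1 o1) (psdmx_smx W2 o2) t01).
have cz : convmx t V W1 W2 z (vpow b1 r^-1) (vpow b2 r^-1) by split.
have := lieb_pow r01 K t01 ca cz.
have attained (U' : 'M[C]_n) a' (W' : 'M[C]_k) b' : unitary W' -> orthant b' ->
    adj K *m smx U' (vpow a' r) *m K = smx W' b' ->
    lform (fun x y => x `^ r * y `^ (1 - r)) U' a' W' (vpow b' r^-1) K =
    \sum_j b' 0 j `^ r^-1.
  move=> hW' b'0 e; rewrite (lform_pow _ _ e) hW'; apply: eq_bigr => j _.
  rewrite (bigD1 j) //= big1 => [|l lj]; last first.
    by rewrite mxE (negPf lj) nsq0 mulr0.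
  have -> : (1%:M : 'M[C]_k) j j = 1%:C by rewrite mxE eqxx.
  rewrite nsq_real expr1n mulr1 addr0 vpowE -powRrM.
  rewrite -[X in _ * X]powRr1 ?orthantP // -powRD_ge0 //; last first.
    by rewrite mulr_ge0 ?invr_ge0 ?subr_ge0 // ltW.
  by rewrite mulrBr mulr1 mulVf // subrK.
rewrite (attained _ _ _ _ hW1 b10 eb1) (attained _ _ _ _ hW2 b20 eb2).
have eT := sum_conv cz.
have e1 : \sum_j vpow b1 r^-1 0 j = \sum_j b1 0 j `^ r^-1.
  by apply: eq_bigr => j _; rewrite vpowE.
have e2 : \sum_j vpow b2 r^-1 0 j = \sum_j b2 0 j `^ r^-1.
  by apply: eq_bigr => j _; rewrite vpowE.
rewrite e1 e2 in eT; rewrite -eT => hT.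
have hVW : unitary (W *m adj V).
  by rewrite /unitary adjM adjK mulmxA -(mulmxA W) unitaryKV // mulmx1.
have young_sum : lform (fun x y => x `^ r * y `^ (1 - r)) U a V z K <=
    r * (\sum_j b 0 j `^ r^-1) + (1 - r) * (\sum_j z 0 j).
  rewrite (lform_pow _ _ eb).
  (* The squared moduli of the entries of [W *m adj V] are doubly stochastic, so the scalar Young
     inequality for each pair of eigenvalues adds up to the two traces. *)
  apply: (@le_trans _ _ (\sum_j \sum_l
      (r * b 0 l `^ r^-1 + (1 - r) * z 0 j) * nsq ((W *m adj V) l j))).
    apply: ler_sum => j _; rewrite mulr_sumr; apply: ler_sum => l _.
    rewrite mulrA ler_wpM2r ?nsq_ge0 //.
    have := @young R (b 0 l `^ r^-1) (z 0 j) r (1 - r) (powR_ge0 _ _) (orthantP j z0) r0.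
    rewrite -powRrM mulVf // powRr1 ?orthantP // [X in X <= _]mulrC; apply.
      by rewrite subr_gt0.
    by rewrite addrC subrK.
  under eq_bigr do (under eq_bigr do rewrite mulrDl; rewrite big_split /=).
  rewrite big_split /= exchange_big /= 2!mulr_sumr.
  apply: lerD; apply: ler_sum => j _.
    by rewrite -mulr_sumr (row_nv1 _ hVW) mulr1.
  by rewrite -mulr_sumr (col_nv1 _ hVW) mulr1.
have := le_trans hT young_sum.
move: (\sum_j z 0 j) (\sum_j b 0 j `^ r^-1) => T S h.
by rewrite -(ler_pM2l r0); lra.
Qed.

End Epstein.

(** * From the trace to concave symmetric forms *)

Section FormEpstein.
Context {R : realType}.
Local Notation C := R[i].

Lemma psdmx_mxpow n (A : 'M[C]_n) r : psdmx A -> psdmx (mxpow A r).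
Proof.
case/psd_dec => U [a [hU _ ->]]; rewrite mxpow_smx //.
exact/psdmx_smx/orthant_vpow.
Qed.

(* Compressing to the bottom k eigenvectors at the intermediate point reduces the
   concavity of the sum of the k smallest eigenvalues to that of a trace. *)
Lemma bottom_epstein n m (t r : R) (U U1 U2 : 'M[C]_n) (a a1 a2 : 'rV[R]_n)
    (L : 'M[C]_(n, m)) (W W1 W2 : 'M[C]_m) (b b1 b2 : 'rV[R]_m) k :
  0 <= t <= 1 -> 0 < r < 1 -> convmx t U U1 U2 a a1 a2 ->
  unitary W -> unitary W1 -> unitary W2 -> orthant b -> orthant b1 -> orthant b2 ->
  asc b1 -> asc b2 ->
  adj L *m smx U (vpow a r) *m L = smx W b ->
  adj L *m smx U1 (vpow a1 r) *m L = smx W1 b1 ->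
  adj L *m smx U2 (vpow a2 r) *m L = smx W2 b2 ->
  \sum_(i < m | (i < k)%N) (t * b1 0 i `^ r^-1 + (1 - t) * b2 0 i `^ r^-1) <=
  \sum_(i < m | (i < k)%N) b 0 i `^ r^-1.
Proof.
move=> t01 r01 ca hW hW1 hW2 b0 b10 b20 as1 as2 eb eb1 eb2.
wlog hk : k / (k <= m)%N.
  move=> hw; have [/hw //|/ltnW mk] := leqP k m.
  have e (z : 'I_m -> R) : \sum_(i < m | (i < k)%N) z i = \sum_(i < m | (i < m)%N) z i.
    by apply: eq_bigl => i; rewrite ltn_ord (leq_trans (ltn_ord i)).
  by rewrite !e; apply: hw.
have winj : injective (widen_ord hk) by move=> i j /(congr1 val) /= ij; apply: val_inj.
have [E eE] : exists E, E = colsub (widen_ord hk) (adj W) by eexists.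
have EE : adj E *m E = 1%:M by rewrite eE; exact: compress_isometry.
have eK X : adj (L *m E) *m X *m (L *m E) = adj E *m (adj L *m X *m L) *m E.
  by rewrite adjM !mulmxA.
have /andP[/ltW r0 _] := r01.
(* [E] is not adapted to the eigenvectors at the end points, but interlacing keeps the compressed
   spectrum there above the [k] smallest eigenvalues, which is the useful direction. *)
have sub (V : 'M[C]_n) c (X : 'M[C]_m) d : unitary X -> orthant d -> asc d ->
    adj L *m smx V (vpow c r) *m L = smx X d -> exists Z g, [/\ unitary Z, orthant g,
    adj (L *m E) *m smx V (vpow c r) *m (L *m E) = smx Z g &
    forall i, d 0 (widen_ord hk i) <= g 0 i].
  move=> hX d0 da e.
  have [Z [g [hZ g0 ag eg]]] := psd_dec_asc
    (psdmx_congr (L *m E) (psdmx_smx V (orthant_vpow c r))).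
  exists Z, g; split => // i; apply: (@eig_ge _ _ _ X d Z g E) => // y.
    by rewrite (@qv_congr _ _ _ X d Z g E) // -eg -e eK.
  exact: nv_isometry.
have [Z1 [g1 [hZ1 g10 eg1 le1]]] := sub U1 a1 W1 b1 hW1 b10 as1 eb1.
have [Z2 [g2 [hZ2 g20 eg2 le2]]] := sub U2 a2 W2 b2 hW2 b20 as2 eb2.
have o : orthant (colsub (widen_ord hk) b).
  by move=> i; have := b0 (widen_ord hk i); rewrite !mxE.
have eg : adj (L *m E) *m smx U (vpow a r) *m (L *m E) =
    smx 1%:M (colsub (widen_ord hk) b).
  by rewrite smx1 eK eb eE compress_smx.
rewrite !(big_ord_narrow hk).
have -> : \sum_i b 0 (widen_ord hk i) `^ r^-1 =
    \sum_i (colsub (widen_ord hk) b) 0 i `^ r^-1.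
  by apply: eq_bigr => i _; rewrite [in RHS]mxE.
apply: le_trans (trace_epstein t01 r01 ca (unitary1 k) hZ1 hZ2 o g10 g20 eg eg1 eg2).
have /andP[t0 t1] := t01.
rewrite big_split /= -!mulr_sumr.
have mono (d : 'rV[R]_m) (g : 'rV[R]_k) : orthant d -> orthant g ->
    (forall i, d 0 (widen_ord hk i) <= g 0 i) ->
    \sum_i d 0 (widen_ord hk i) `^ r^-1 <= \sum_i g 0 i `^ r^-1.
  move=> d0 g0 h; apply: ler_sum => i _.
  by apply: ge0_ler_powR; rewrite ?nnegrE ?orthantP // invr_ge0.
by apply: lerD; apply: ler_wpM2l; rewrite ?subr_ge0 //; apply: mono.
Qed.

Lemma form_epstein n m (phi : 'rV[R]_m -> R) (A1 A2 : 'M[C]_n) (L : 'M[C]_(n, m))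
    (t r : R) :
  hcform phi -> psdmx A1 -> psdmx A2 -> 0 <= t <= 1 -> 0 < r < 1 ->
  t * form_mx phi (mxpow (adj L *m mxpow A1 r *m L) r^-1) +
  (1 - t) * form_mx phi (mxpow (adj L *m mxpow A2 r *m L) r^-1) <=
  form_mx phi (mxpow (adj L *m mxpow (t%:C *: A1 + (1 - t)%:C *: A2) r *m L) r^-1).
Proof.
move=> hphi pA1 pA2 t01 r01.
have pA := psdmx_conv pA1 pA2 t01.
have [U1 [a1 [hU1 a10 eA1]]] := psd_dec pA1.
have [U2 [a2 [hU2 a20 eA2]]] := psd_dec pA2.
have [U [a [hU a0 eA]]] := psd_dec pA.
have ca : convmx t U U1 U2 a a1 a2 by split => //; rewrite -eA eA1 eA2.
rewrite eA eA1 eA2 !mxpow_smx //.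
have pN (V : 'M[C]_n) c := psdmx_congr L (psdmx_smx V (orthant_vpow c r)).
have [W [b [hW b0 ab eb]]] := psd_dec_asc (pN U a).
have [W1 [b1 [hW1 b10 ab1 eb1]]] := psd_dec_asc (pN U1 a1).
have [W2 [b2 [hW2 b20 ab2 eb2]]] := psd_dec_asc (pN U2 a2).
rewrite eb eb1 eb2 !mxpow_smx //.
have op := @orthant_vpow R m.
have hp := hc_perm hphi.
rewrite !form_mx_smx //.
apply: le_trans (hc_concave hphi (op b1 r^-1) (op b2 r^-1) t01) _.
set d := _ + _.
have od : orthant d by apply: orthant_conv.
(* Negation turns ascending spectra into descending ones and the superlevel set of [phi], convex by
   concavity, into a downward closed set. Membership in the orthant is recorded because [phi] is
   controlled only there. *)
pose S (z : 'rV[R]_m) : Prop := orthant (- z) /\ phi d <= phi (- z).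
have /andP[r0 r1] := r01.
suff [_] : S (- vpow b r^-1) by rewrite opprK.
apply: (@weak_majorization R m S _ _ _ (- vpow b r^-1) (- d)).
- move=> z g [oz hz].
  rewrite /S; have -> : - col_perm g z = col_perm g (- z).
    by apply/rowP => i; rewrite !mxE.
  split; last by rewrite hp.
  by move=> i; have := oz (g i); rewrite !mxE.
- move=> x y u [ox hx] [oy hy] u01.
  have e : - (u *: x + (1 - u) *: y) = u *: (- x) + (1 - u) *: (- y).
    by rewrite opprD !scalerN.
  rewrite /S e; split; first exact: orthant_conv.
  apply: le_trans (hc_concave hphi ox oy u01).
  have /andP[u0 u1] := u01.
  have -> : phi d = u * phi d + (1 - u) * phi d by rewrite -mulrDl addrC subrK mul1r.
  by apply: lerD; apply: ler_wpM2l; rewrite // subr_ge0.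
- move=> x y [oy hy] h.
  have h' : vle (- y) (- x) by move=> i; rewrite !mxE lerN2.
  split; first exact: orthant_le oy h'.
  exact: le_trans hy (hc_le hphi oy h').
- move=> i j ij; rewrite !mxE lerN2.
  apply: ge0_ler_powR; rewrite ?nnegrE ?orthantP //; last exact: ab.
  by rewrite invr_ge0 ltW.
- move=> k.
  have sN (z : 'rV[R]_m) : \sum_(i < m | (i < k)%N) (- z) 0 i =
      - \sum_(i < m | (i < k)%N) z 0 i.
    by rewrite -sumrN; apply: eq_bigr => i _; rewrite mxE.
  rewrite !sN lerN2.
  have := bottom_epstein k t01 r01 ca hW hW1 hW2 b0 b10 b20 ab1 ab2 eb eb1 eb2.
  have -> : \sum_(i < m | (i < k)%N) d 0 i =
      \sum_(i < m | (i < k)%N) (t * b1 0 i `^ r^-1 + (1 - t) * b2 0 i `^ r^-1).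
    by apply: eq_bigr => i _; rewrite /d !mxE.
  have -> // : \sum_(i < m | (i < k)%N) vpow b r^-1 0 i =
      \sum_(i < m | (i < k)%N) b 0 i `^ r^-1.
  by apply: eq_bigr => i _; rewrite vpowE.
- by rewrite /S opprK.
Qed.

End FormEpstein.

(** * The variational formula and its perturbation *)

Section Variational.
Context {R : realType}.
Local Notation C := R[i].

Lemma qvD n (U : 'M[C]_n) (a b : 'rV[R]_n) y : qv U (a + b) y = qv U a y + qv U b y.
Proof. by rewrite /qv -big_split; apply: eq_bigr => i _; rewrite mxE mulrDl. Qed.

Lemma qv_const n (U : 'M[C]_n) c y : unitary U -> qv U (const_mx c) y = c * nv y.
Proof.
move=> hU; rewrite -(nv_unitary y hU) mulr_sumr.
by apply: eq_bigr => i _; rewrite mxE.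
Qed.

(** The trace stands in for the operator norm in the choice of the perturbation. *)
Lemma qv_le_sum n (U : 'M[C]_n) (a : 'rV[R]_n) y : unitary U -> orthant a ->
  qv U a y <= (\sum_i a 0 i) * nv y.
Proof.
move=> hU a0; rewrite -(nv_unitary y hU); apply: (@supp_le _ _ _ _ predT) => // j _.
by rewrite (bigD1 j) //= lerDl sumr_ge0 // => i _; rewrite orthantP.
Qed.

Lemma qv_ge0 n (U : 'M[C]_n) (a : 'rV[R]_n) y : orthant a -> 0 <= qv U a y.
Proof.
by move=> a0; apply: sumr_ge0 => i _; rewrite mulr_ge0 ?orthantP ?nsq_ge0.
Qed.

Lemma qv_eigen n (U : 'M[C]_n) (a : 'rV[R]_n) i : unitary U ->
  qv U a (adj U *m delta_mx i 0) = a 0 i.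
Proof.
move=> hU; rewrite /qv mulmxA hU mul1mx (bigD1 i) //= big1 => [|j ji].
  have -> : (delta_mx i 0 : 'cV[C]_n) i 0 = 1%:C by rewrite mxE !eqxx.
  by rewrite nsq_real expr1n mulr1 addr0.
have -> : (delta_mx i 0 : 'cV[C]_n) j 0 = 0 by rewrite mxE (negPf ji).
by rewrite nsq0 mulr0.
Qed.

Lemma qv_gram n (U : 'M[C]_n) (a : 'rV[R]_n) m (X : 'M[C]_(m, n)) y :
  adj X *m X = smx U a -> qv U a y = nv (X *m y).
Proof. by move=> e; apply: real_inj; rewrite -nvE -qvE -e adjM !mulmxA. Qed.

Lemma form_mx_mono m (phi : 'rV[R]_m -> R) (X : 'M[C]_m) (V : 'M[C]_m)
    (y : 'rV[R]_m) c :
  hcform phi -> 0 <= c -> psdmx X -> unitary V -> orthant y -> desc y ->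
  (forall U a v, unitary U -> X = smx U a -> qv U a v <= qv V y v) ->
  form_mx phi (mxpow X c) <= phi (vpow y c).
Proof.
move=> hphi c0 pX hV y0 dy h.
have [U [a [hU a0 da eX]]] := psd_dec_desc pX.
have hp := hc_perm hphi.
rewrite eX mxpow_smx // form_mx_smx //; last exact: orthant_vpow.
apply: (hc_le hphi); first exact: orthant_vpow.
by apply: vpow_le => //; apply: (eig_mono hV hU) => // v; apply: h.
Qed.

(** The matrices [H S^2 H] and [S H^2 S = S N S + e S^2] share their spectrum [w]. The first is
    [H (S^2 + e) H] up to [e H^2], the second is [S N S] up to [e S^2], so [y] and [x] are compared
    through [w]. *)
Lemma perturbed_sandwich m (N S : 'M[C]_m) (W : 'M[C]_m) (x : 'rV[R]_m) (d : R) :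
  psdmx N -> adj S = S -> unitary W -> desc x -> S *m N *m S = smx W x -> 0 < d ->
  exists e H Hi V (y : 'rV[R]_m) Un Ub (u g : 'rV[R]_m),
  [/\ [/\ 0 < e, N = smx Un u /\ S *m S = smx Ub g & unitary Un /\ unitary Ub],
      [/\ adj H = H, adj Hi = Hi, H *m H = smx Un (u + const_mx e), Hi *m H = 1%:M
        & H *m Hi = 1%:M],
      H *m smx Ub (g + const_mx e) *m H = smx V y,
      [/\ unitary V, desc y & forall i, 0 < y 0 i] &
      vle y (x + const_mx d)].
Proof.
move=> pN aS hW dx ex d0.
have [Un [u [hUn u0 eN]]] := psd_dec pN.
have := psdmx_gram S; rewrite aS => pSS.
have [Ub [g [hUb g0 eS]]] := psd_dec pSS.
pose nu := \sum_i u 0 i; pose ga := \sum_i g 0 i.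
have nu0 : 0 <= nu by apply: sumr_ge0 => i _; rewrite orthantP.
have ga0 : 0 <= ga by apply: sumr_ge0 => i _; rewrite orthantP.
(* The two comparisons cost [e * ga] and [e * (nu + e)]; with [e <= 1] their sum is at most
   [e * (ga + nu + 1)]. *)
have [e [e0 e1 ed]] : exists e, [/\ 0 < e, e <= 1 & e * (ga + nu + 1) <= d].
  have c0 : 0 < ga + nu + 1 by rewrite ltr_wpDl ?addr_ge0.
  exists (Num.min 1 (d / (ga + nu + 1))); split.
  - by rewrite lt_min ltr01 divr_gt0.
  - by rewrite ge_min lexx.
  - by rewrite -ler_pdivlMr // ge_min lexx orbT.
have ue i : 0 < (u + const_mx e) 0 i by rewrite !mxE ltr_wpDl ?orthantP.
have [H [Hi [aH aHi HH HiH HHi]]] := smx_sqrt hUn ue.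
have oge : orthant (g + const_mx e).
  by move=> i; rewrite !mxE addr_ge0 ?orthantP // ltW.
have := psdmx_congr H (psdmx_smx Ub oge); rewrite aH => pM.
have [V [y [hV y0 dy ey]]] := psd_dec_desc pM.
have qy v : qv V y v = qv Ub g (H *m v) + e * nv (H *m v).
  rewrite -(qv_const e (H *m v) hUb) -qvD; apply: qv_congr.
  by rewrite aH ey.
exists e, H, Hi, V, y, Un, Ub, u, g; split => //.
  split => // i; rewrite -(qv_eigen y i hV) qy.
  rewrite ltr_wpDl ?qv_ge0 // mulr_gt0 // nv_gt0 //.
  apply/eqP => h; have : qv V (const_mx 1) (adj V *m delta_mx i 0) = 0.
    rewrite qv_const // -[X in nv X]mul1mx -HiH -mulmxA h mulmx0 /nv.
    rewrite big1 ?mulr0 // => j _.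
    by rewrite mxE nsq0.
  by rewrite qv_eigen // mxE => /eqP; rewrite oner_eq0.
have := psdmx_gram (H *m S) => /psd_dec_desc [Q [w [hQ w0 dw ew]]].
have := psdmx_gram (adj (H *m S)); rewrite adjK.
move=> /psd_dec_desc [Q' [w' [hQ' w'0 dw' ew']]].
have ww : w' = w := eig_swap hQ' hQ dw' dw w'0 w0 ew' ew.
rewrite ww in ew'.
have wx : vle w (x + const_mx (e * ga)).
  apply: (eig_mono hW hQ) => // [i j ij|v].
    by rewrite !mxE lerD2r dx.
  have -> : qv Q w v = qv Un u (S *m v) + e * nv (S *m v).
    rewrite -(qv_const e (S *m v) hUn) -qvD; apply: qv_congr.
    by rewrite -ew -HH adjM aH aS !mulmxA.
  rewrite qvD qv_const // lerD //.
    by rewrite (@qv_congr _ _ _ Un u W x S) // -ex eN aS.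
  rewrite -mulrA ler_wpM2l ?(ltW e0) //.
  by rewrite -(@qv_gram _ Ub g _ S v) ?aS //; apply: qv_le_sum.
have yw : vle y (w + const_mx (e * (nu + e))).
  apply: (eig_mono hQ' hV) => // [i j ij|v].
    by rewrite !mxE lerD2r dw.
  rewrite qy qvD qv_const // lerD //.
    rewrite (@qv_congr _ _ _ Ub g Q' w H) // -ew' adjM aS aH -eS.
    by rewrite !mulmxA.
  rewrite -mulrA ler_wpM2l ?(ltW e0) //.
  rewrite -(@qv_gram _ Un (u + const_mx e) _ H v) ?aH //.
  by rewrite qvD qv_const // mulrDl lerD2r; apply: qv_le_sum.
move=> i; apply: le_trans (yw i) _; rewrite !mxE.
have := wx i; rewrite !mxE => wi; apply: le_trans (lerD wi (lexx _)) _.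
rewrite -addrA lerD2l; apply: le_trans ed.
by rewrite -mulrDr ler_wpM2l ?(ltW e0) //; lra.
Qed.

(* With Z = H^-1 D, D = (H G H)^(p/2) and H^2 = N, both terms of the Young bound
   equal phi ((H G H)^(1/s)); N and G are made invertible by a perturbation. *)
Lemma variational_near m (phi : 'rV[R]_m -> R) (N S G : 'M[C]_m) (s p q eta : R) :
  hcform phi -> psdmx N -> adj S = S -> S *m S = G ->
  0 < s -> 0 < p -> 0 < q -> p + q = 1 ->
  psdmx (S *m N *m S) -> 0 < eta ->
  exists Z Zi : 'M[C]_m, Zi *m Z = 1%:M /\
  p * form_mx phi (mxpow (adj Z *m N *m Z) (p * s)^-1) +
  q * form_mx phi (mxpow (Zi *m G *m adj Zi) (q * s)^-1) <=
  form_mx phi (mxpow (S *m N *m S) (1 / s)) + eta.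
Proof.
move=> hphi pN aS <- s0 p0 q0 pq pM eta0.
have [W [x [hW x0 dx ex]]] := psd_dec_desc pM.
have hp := hc_perm hphi.
have si0 : 0 < 1 / s by rewrite divr_gt0.
rewrite ex mxpow_smx // form_mx_smx //; last exact: orthant_vpow.
have [d1 d10 hd1] := hc_cont hphi (orthant_vpow x (1 / s)) eta0.
have [d2 d20 hd2] := vpow_upper_cont x0 si0 d10.
have [e [H [Hi [V [y [Un [Ub [u [g]]]]]]]]] := perturbed_sandwich pN aS hW dx ex d20.
move=> [[e0 [eN eS] [hUn hUb]] [aH aHi HH HiH HHi] eM [hV dy y0] yx].
have oy : orthant y by move=> i; rewrite mxE ltW.
have top : phi (vpow y (1 / s)) <= phi (vpow x (1 / s)) + eta.
  apply: le_trans hd1; apply: (hc_le hphi); first exact: orthant_vpow.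
  move=> i; apply: le_trans (hd2 i).
  by apply: (vpow_le (ltW si0) oy yx).
have [D eD] : exists D, D = smx V (vpow y (p / 2)) by eexists.
have [Di eDi] : exists D, D = smx V (vpow y (- (p / 2))) by eexists.
have aD : adj D = D by rewrite eD; exact: adj_smx.
have aDi : adj Di = Di by rewrite eDi; exact: adj_smx.
have yn i : y 0 i != 0 by rewrite gt_eqF.
have vD a b : vmul (vpow y a) (vpow y b) = vpow y (a + b).
  by apply/rowP => i; rewrite vmulE !vpowE powRD // yn implybT.
have vy : vpow y 1 = y by rewrite vpow1.
have v1 : vpow y 0 = const_mx 1.
  by apply/rowP => i; rewrite vpowE mxE powRr0.
have DiD : Di *m D = 1%:M.
  by rewrite eD eDi (smxM hV) vD addNr v1 (smx_const hV).
have DD : D *m D = smx V (vpow y p).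
  by rewrite eD (smxM hV) vD -splitr.
(* The relation [p + q = 1] enters here: conjugating by [y^(-p/2)] leaves the exponent
   [1 - p = q]. *)
have DiMDi : Di *m smx V y *m Di = smx V (vpow y q).
  rewrite eDi -{2}vy (smxM hV) (smxM hV) !vD; congr (smx V (vpow y _)); lra.
have mono_desc c : 0 <= c -> desc (vpow y c).
  move=> c0 i j ij; rewrite !vpowE; apply: ge0_ler_powR; rewrite ?nnegrE ?(ltW (y0 _)) //.
  exact: dy.
exists (Hi *m D), (Di *m H); split.
  by rewrite -mulmxA (mulmxA H) HHi mul1mx.
have sn : s != 0 by rewrite gt_eqF.
have pn : p != 0 by rewrite gt_eqF.
have qn : q != 0 by rewrite gt_eqF.
have pe : p * (p * s)^-1 = 1 / s by rewrite invfM mulrA mulfV.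
have qe : q * (q * s)^-1 = 1 / s by rewrite invfM mulrA mulfV.
have -> : phi (vpow x (1 / s)) + eta =
    p * (phi (vpow x (1 / s)) + eta) + q * (phi (vpow x (1 / s)) + eta).
  by rewrite -mulrDl pq [RHS]mul1r.
(* Removing the perturbation only lowers a quadratic form, so both terms with the original [N] and
   [G] lie below the perturbed ones, whose value is exact. *)
have cst n (U : 'M[C]_n) (a : 'rV[R]_n) v : unitary U ->
    qv U a v <= qv U (a + const_mx e) v.
  by move=> hU; rewrite qvD qv_const // lerDl mulr_ge0 ?nv_ge0 // ltW.
apply: lerD; rewrite ler_pM2l //; apply: le_trans top.
  have ep : vpow (vpow y p) (p * s)^-1 = vpow y (1 / s) by rewrite vpowM pe.
  rewrite -ep.
  apply: (@form_mx_mono m phi _ V (vpow y p) _ hphi).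
  - by rewrite invr_ge0 mulr_ge0 // ltW.
  - exact: psdmx_congr.
  - exact: hV.
  - exact: orthant_vpow.
  - exact/mono_desc/ltW.
  move=> U a v hU eX.
  rewrite (@qv_congr _ _ _ Un u U a (Hi *m D) v); last by rewrite -eX eN.
  rewrite (@qv_congr _ _ _ Un (u + const_mx e) V (vpow y p) (Hi *m D) v); last first.
    rewrite -DD -HH adjM aHi aD -!mulmxA (mulmxA H Hi) HHi mul1mx.
    by rewrite (mulmxA Hi H) HiH mul1mx.
  exact: cst.
have eq : vpow (vpow y q) (q * s)^-1 = vpow y (1 / s) by rewrite vpowM qe.
rewrite -eq.
have -> : Di *m H *m (S *m S) *m adj (Di *m H) = adj (H *m Di) *m (S *m S) *m (H *m Di).
  by rewrite !adjM aH aDi.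
apply: (@form_mx_mono m phi _ V (vpow y q) _ hphi).
- by rewrite invr_ge0 mulr_ge0 // ltW.
- by apply: psdmx_congr; have := psdmx_gram S; rewrite aS.
- exact: hV.
- exact: orthant_vpow.
- exact/mono_desc/ltW.
move=> U a v hU eX.
rewrite (@qv_congr _ _ _ Ub g U a (H *m Di) v); last by rewrite -eX eS.
rewrite (@qv_congr _ _ _ Ub (g + const_mx e) V (vpow y q) (H *m Di) v); last first.
  by rewrite -DiMDi -eM adjM aH aDi !mulmxA.
exact: cst.
Qed.

End Variational.

(** * Joint concavity, for [p + q = 1] and then in general *)

Section JointConcavity.
Context {R : realType}.
Local Notation C := R[i].

Lemma adj_mxpow n (A : 'M[C]_n) r : psdmx A -> adj (mxpow A r) = mxpow A r.
Proof. by case/psd_dec => U [a [hU _ ->]]; rewrite mxpow_smx // adj_smx. Qed.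

Lemma mxpow_half n (A : 'M[C]_n) r : psdmx A -> 0 <= r ->
  mxpow A (r / 2) *m mxpow A (r / 2) = mxpow A r.
Proof.
case/psd_dec => U [a [hU _ ->]] r0; rewrite !mxpow_smx // smxM //.
have -> // : vmul (vpow a (r / 2)) (vpow a (r / 2)) = vpow a r.
apply/rowP => i; rewrite vmulE !vpowE -powRD_ge0 ?divr_ge0 //.
by rewrite -splitr.
Qed.

Lemma sandwichE n m (K : 'M[C]_(n, m)) (X : 'M[C]_n) (S : 'M[C]_m) :
  S *m adj K *m X *m K *m S = S *m (adj K *m X *m K) *m S.
Proof. by rewrite !mulmxA. Qed.

Lemma congr_comp n m k (K : 'M[C]_(n, m)) (X : 'M[C]_n) (Z : 'M[C]_(m, k)) :
  adj Z *m (adj K *m X *m K) *m Z = adj (K *m Z) *m X *m (K *m Z).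
Proof. by rewrite adjM !mulmxA. Qed.

Lemma congr_cancel m (N S Z Zi : 'M[C]_m) : adj S = S -> Z *m Zi = 1%:M ->
  adj (Zi *m S) *m (adj Z *m N *m Z) *m (Zi *m S) = S *m N *m S.
Proof.
move=> aS ZZi; rewrite congr_comp (mulmxA Z) ZZi mul1mx aS //.
Qed.

Lemma gram_half m (S Zi : 'M[C]_m) : adj S = S ->
  Zi *m S *m adj (Zi *m S) = Zi *m (S *m S) *m adj Zi.
Proof. by move=> aS; rewrite adjM aS !mulmxA. Qed.

Lemma form_mx_holder_congr m (phi : 'rV[R]_m -> R) (N S G Z Zi : 'M[C]_m)
    (s p q : R) :
  hcform phi -> psdmx N -> adj S = S -> S *m S = G -> Z *m Zi = 1%:M ->
  0 < s -> 0 < p -> 0 < q -> p + q = 1 ->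
  form_mx phi (mxpow (S *m N *m S) (1 / s)) <=
  p * form_mx phi (mxpow (adj Z *m N *m Z) (p * s)^-1) +
  q * form_mx phi (mxpow (Zi *m G *m adj Zi) (q * s)^-1).
Proof.
move=> hphi pN aS <- ZZi s0 p0 q0 pq.
have := form_mx_holder (Zi *m S) hphi (psdmx_congr Z pN) s0 p0 q0 pq.
by rewrite (congr_cancel N aS ZZi) (gram_half Zi aS) (div1r (p * s)) (div1r (q * s)).
Qed.

Lemma form_epstein_congr n m (phi : 'rV[R]_m -> R) (A1 A2 : 'M[C]_n)
    (K : 'M[C]_(n, m)) (Z : 'M[C]_m) (t r : R) :
  hcform phi -> psdmx A1 -> psdmx A2 -> 0 <= t <= 1 -> 0 < r < 1 ->
  t * form_mx phi (mxpow (adj Z *m (adj K *m mxpow A1 r *m K) *m Z) r^-1) +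
  (1 - t) * form_mx phi (mxpow (adj Z *m (adj K *m mxpow A2 r *m K) *m Z) r^-1) <=
  form_mx phi (mxpow (adj Z *m (adj K *m
    mxpow (t%:C *: A1 + (1 - t)%:C *: A2) r *m K) *m Z) r^-1).
Proof.
move=> hphi pA1 pA2 t01 r01; have := form_epstein (K *m Z) hphi pA1 pA2 t01 r01.
move: (mxpow A1 r) (mxpow A2 r) (mxpow (_ + _) r) => X1 X2 X.
by rewrite !congr_comp.
Qed.

Lemma form_epstein_adj m (phi : 'rV[R]_m -> R) (B1 B2 Z : 'M[C]_m) (t r : R) :
  hcform phi -> psdmx B1 -> psdmx B2 -> 0 <= t <= 1 -> 0 < r < 1 ->
  t * form_mx phi (mxpow (Z *m mxpow B1 r *m adj Z) r^-1) +
  (1 - t) * form_mx phi (mxpow (Z *m mxpow B2 r *m adj Z) r^-1) <=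
  form_mx phi (mxpow (Z *m mxpow (t%:C *: B1 + (1 - t)%:C *: B2) r *m adj Z) r^-1).
Proof.
move=> hphi pB1 pB2 t01 r01; have := form_epstein (adj Z) hphi pB1 pB2 t01 r01.
by rewrite adjK.
Qed.

Lemma convex_combine (t p q F1 F2 L L1 L2 M M1 M2 : R) :
  0 <= t <= 1 -> 0 < p -> 0 < q ->
  F1 <= p * L1 + q * M1 -> F2 <= p * L2 + q * M2 ->
  t * L1 + (1 - t) * L2 <= L -> t * M1 + (1 - t) * M2 <= M ->
  t * F1 + (1 - t) * F2 <= p * L + q * M.
Proof.
move=> /andP[t0 t1] p0 q0 h1 h2 hL hM; have t1' : 0 <= 1 - t by rewrite subr_ge0.
apply: le_trans (lerD (ler_wpM2l t0 h1) (ler_wpM2l t1' h2)) _.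
apply: le_trans (lerD (ler_wpM2l (ltW p0) hL) (ler_wpM2l (ltW q0) hM)).
by rewrite le_eqVlt; apply/orP; left; apply/eqP; ring.
Qed.

Lemma convex_powR (t r F1 F2 F3 G1 G2 G3 : R) :
  0 <= t <= 1 -> 0 < r <= 1 -> 0 <= G1 -> 0 <= G2 ->
  F1 = G1 `^ r -> F2 = G2 `^ r -> F3 = G3 `^ r ->
  t * G1 + (1 - t) * G2 <= G3 -> t * F1 + (1 - t) * F2 <= F3.
Proof.
move=> t01 r01 G10 G20 -> -> -> h; apply: le_trans (powR_concave G10 G20 t01 r01) _.
have /andP[t0 t1] := t01; have /andP[/ltW r0 _] := r01.
have c0 : 0 <= t * G1 + (1 - t) * G2 by rewrite addr_ge0 // mulr_ge0 // subr_ge0.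
by apply: ge0_ler_powR; rewrite ?nnegrE // (le_trans c0).
Qed.

Lemma psdmx_sandwich n m (A : 'M[C]_n) (B : 'M[C]_m) (K : 'M[C]_(n, m)) a b :
  psdmx A -> psdmx B -> psdmx (mxpow B b *m (adj K *m mxpow A a *m K) *m mxpow B b).
Proof.
move=> pA pB; rewrite -{1}(adj_mxpow b pB).
exact/psdmx_congr/psdmx_congr/psdmx_mxpow.
Qed.

Lemma joint_concavity_conjugate n m (phi : 'rV[R]_m -> R) (s p q : R)
    (K : 'M[C]_(n, m)) :
  hcform phi -> 0 < s <= 1 -> 0 < p -> 0 < q -> p + q = 1 ->
  jointly_concave_psd (fun (A : 'M[C]_n) (B : 'M[C]_m) =>
    form_mx phi (mxpow (mxpow B (q * s / 2) *m (adj K *m mxpow A (p * s) *m K)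
      *m mxpow B (q * s / 2)) (1 / s))).
Proof.
move=> hphi /andP[s0 s1] p0 q0 pq A1 A2 B1 B2 t pA1 pA2 pB1 pB2 t01.
have /andP[t0 t1] := t01; have t1' : 0 <= 1 - t by rewrite subr_ge0.
have pA := psdmx_conv pA1 pA2 t01; have pB := psdmx_conv pB1 pB2 t01.
have ps0 : 0 < p * s by rewrite mulr_gt0.
have qs0 : 0 < q * s by rewrite mulr_gt0.
(* Since [q > 0] forces [p < 1], the exponent is strictly below 1 even when [s = 1]. *)
have r1 : 0 < p * s < 1.
  by rewrite ps0 /= (@le_lt_trans _ _ p) ?ler_piMr ?(ltW p0) //; lra.
have r2 : 0 < q * s < 1.
  by rewrite qs0 /= (@le_lt_trans _ _ q) ?ler_piMr ?(ltW q0) //; lra.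
apply/ler_addgt0Pr => eta eta0.
move: (pA) (pB); set A := _ + _; set B := _ + _ => pA' pB'.
pose N (X : 'M[C]_n) := adj K *m mxpow X (p * s) *m K.
have pN X : psdmx X -> psdmx (N X) by move=> pX; apply/psdmx_congr/psdmx_mxpow.
pose S (Y : 'M[C]_m) := mxpow Y (q * s / 2).
change (t * form_mx phi (mxpow (S B1 *m N A1 *m S B1) (1 / s)) +
  (1 - t) * form_mx phi (mxpow (S B2 *m N A2 *m S B2) (1 / s)) <=
  form_mx phi (mxpow (S B *m N A *m S B) (1 / s)) + eta).
have aS Y : psdmx Y -> adj (S Y) = S Y by move=> pY; apply: adj_mxpow.
have pSNS : psdmx (S B *m N A *m S B).
  by have := psdmx_congr (S B) (pN A pA'); rewrite aS.
have SS Y : psdmx Y -> S Y *m S Y = mxpow Y (q * s).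
  by move=> pY; apply: mxpow_half => //; apply: ltW.
(* [Z] is chosen nearly optimal at the intermediate point and then kept: at the end points the Young
   bound holds for every invertible [Z]. *)
have [Z [Zi [ZiZ hZ]]] :=
  variational_near hphi (pN A pA') (aS B pB') (SS B pB') s0 p0 q0 pq pSNS eta0.
apply: le_trans hZ; have ZZi := mulmx1C ZiZ.
have bound X Y (pX : psdmx X) (pY : psdmx Y) :=
  form_mx_holder_congr hphi (pN X pX) (aS Y pY) (SS Y pY) ZZi s0 p0 q0 pq.
exact: (convex_combine t01 p0 q0 (bound A1 B1 pA1 pB1) (bound A2 B2 pA2 pB2)
  (form_epstein_congr K Z hphi pA1 pA2 t01 r1) (form_epstein_adj Zi hphi pB1 pB2 t01 r2)).
Qed.

Lemma form_mx_pow m (phi : 'rV[R]_m -> R) (M : 'M[C]_m) (c r : R) :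
  hcform phi -> 0 < r <= 1 -> psdmx M ->
  form_mx (pow_form phi r) (mxpow M c) `^ r = form_mx phi (mxpow M (c * r)).
Proof.
move=> hphi r01 /psd_dec [U [a [hU a0 ->]]].
have hp := hc_perm hphi; have hp' := hc_perm (hcform_pow hphi r01).
rewrite !mxpow_smx // !form_mx_smx //; try exact: orthant_vpow.
have /andP[r0 _] := r01.
rewrite /pow_form vpowM -powRrM mulVf ?gt_eqF // powRr1 //.
by apply: (hc_ge0 hphi); apply: orthant_vpow.
Qed.

(** With [r = p + q], passing to [(s r, p / r, q / r)] keeps [p * s] and [q * s] and makes the last
    two add up to 1. The changed outer exponent is absorbed by [pow_form phi r], whose [r]-th power
    restores the original function, and [a^r] is increasing and concave. *)
Lemma joint_concavity n m (phi : 'rV[R]_m -> R) (s p q : R) (K : 'M[C]_(n, m)) :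
  hcform phi -> 0 < s <= 1 -> 0 < p -> 0 < q -> p + q <= 1 ->
  jointly_concave_psd (fun (A : 'M[C]_n) (B : 'M[C]_m) =>
    form_mx phi (mxpow (mxpow B (q * s / 2) *m (adj K *m mxpow A (p * s) *m K)
      *m mxpow B (q * s / 2)) (1 / s))).
Proof.
move=> hphi /andP[s0 s1] p0 q0 pq A1 A2 B1 B2 t pA1 pA2 pB1 pB2 t01.
have [r er] : exists r, r = p + q by exists (p + q).
have r0 : 0 < r by rewrite er addr_gt0.
have r1 : r <= 1 by rewrite er.
have r01 : 0 < r <= 1 by rewrite r0 r1.
have rn : r != 0 by rewrite gt_eqF.
have sn : s != 0 by rewrite gt_eqF.
have hpsi := hcform_pow hphi r01.
have s'01 : 0 < s * r <= 1 by rewrite mulr_gt0 //= mulr_ile1 // ltW.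
have pq' : p / r + q / r = 1 by rewrite -mulrDl -er mulfV.
have := joint_concavity_conjugate K hpsi s'01 (divr_gt0 p0 r0) (divr_gt0 q0 r0) pq'.
move=> /(_ A1 A2 B1 B2 t pA1 pA2 pB1 pB2 t01).
have -> : q / r * (s * r) / 2 = q * s / 2 by field.
have -> : p / r * (s * r) = p * s by field.
have pA := psdmx_conv pA1 pA2 t01; have pB := psdmx_conv pB1 pB2 t01.
have p1 := psdmx_sandwich K (p * s) (q * s / 2) pA1 pB1.
have p2 := psdmx_sandwich K (p * s) (q * s / 2) pA2 pB2.
have p3 := psdmx_sandwich K (p * s) (q * s / 2) pA pB.
have es : 1 / s = 1 / (s * r) * r by field; rewrite rn sn.
have key M : psdmx M -> form_mx phi (mxpow M (1 / s)) =
    form_mx (pow_form phi r) (mxpow M (1 / (s * r))) `^ r.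
  by move=> pM; rewrite es (form_mx_pow _ hphi r01 pM).
move=> h; have ge0 M : 0 <= form_mx (pow_form phi r) M by apply: powR_ge0.
exact: (convex_powR t01 r01 (ge0 _) (ge0 _) (key _ p1) (key _ p2) (key _ p3) h).
Qed.

End JointConcavity.

Local Open Scope complex_scope.

Theorem theorem2p5 (R : realType) (n m : nat) (hn : (1 <= n)%N) (hm : (1 <= m)%N)
    (phi : 'rV[R]_m -> R)
    (hphi : symform phi) (hholder : holder_form phi)
    (hconc : concave_form phi)
    (s p q : R) (hs : 0 < s <= 1) (hp : 0 < p <= 1) (hq : 0 < q <= 1)
    (hpq : p + q <= 1) (K : 'M[R[i]]_(n, m)) :
  jointly_concave_psd (fun (A : 'M[R[i]]_n) (B : 'M[R[i]]_m) =>
    form_mx phi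
      (mxpow (mxpow B (q * s / 2) *m K^t* *m mxpow A (p * s) *m K
              *m mxpow B (q * s / 2)) (1 / s))).
Proof.
have /andP[p0 _] := hp; have /andP[q0 _] := hq.
have hc := symform_hc hphi hholder hconc.
move=> A1 A2 B1 B2 t pA1 pA2 pB1 pB2 t01.
have := joint_concavity K hc hs p0 q0 hpq pA1 pA2 pB1 pB2 t01.
rewrite /=.
move: (mxpow B1 _) (mxpow B2 _) (mxpow (_ + _) (q * s / 2)) => S1 S2 S.
move: (mxpow A1 _) (mxpow A2 _) (mxpow (_ + _) (p * s)) => X1 X2 X.
by rewrite -3!sandwichE.
Qed.
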